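(* Let $n>4$ be an integer, let $K=\{123,321\}\{132,213\}$, and let $f(n)$ be the number of equivalence classes of $S_n$ under $K$-equivalence. Then $$f(n)=\binom{n}{\lfloor n/2\rfloor}+\binom{n-2}{\lfloor (n-2)/2\rfloor}+3.$$
   Context: Permutations in $S_n$ are written as words $\pi_1\pi_2\cdots\pi_n$ in one-line notation. The order permutation of a word $u$ of $c$ distinct positive integers is the unique $\sigma\in S_c$ with $\sigma_i<\sigma_j$ iff $u_i<u_j$. A replacement partition $K$ of $S_c$ is a set partition of $S_c$; it is denoted by listing its parts with the one-element parts (and outer brackets) omitted, so here $K$ is the set partition of $S_3$ whose only parts of size greater than one are $\{123,321\}$ and $\{132,213\}$. The $K$-equivalence on $S_n$ is the equivalence relation generated by: $\phi\equiv\psi$ whenever $\phi=aub$ and $\psi=avb$ (concatenations) for some possibly empty words $a,b$ and words $u,v$ of length $c$ (so $u,v$ occupy the same $c$ consecutive positions) such that the order permutations of $u$ and $v$ lie in the same part of $K$. All equivalence classes are counted, including one-element classes. *)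

(* Defs.v *)
From mathcomp Require Import all_boot fingroup perm.

Set Implicit Arguments.
Unset Strict Implicit.
Unset Printing Implicit Defensive.

(* Letters run over {1, ..., n}, whereas ordinals start at 0. *)
Definition one_line n (s : 'S_n) : seq nat := [seq (s i).+1 | i <- enum 'I_n].

Definition is_order_perm c (u : seq nat) (s : 'S_c) : bool :=
  (size u == c)
  && [forall i : 'I_c, forall j : 'I_c, (s i < s j) == (nth 0 u i < nth 0 u j)].

Definition same_part c (K : {set {set 'S_c}}) (u v : seq nat) : bool :=
  [exists P in K, exists s in P, exists t in P,
     is_order_perm u s && is_order_perm v t].

(* k is the length of the common prefix a in phi = a u b, psi = a v b; see
   K_stepP for the formulation with explicit factorisations. *)
Definition K_step c (K : {set {set 'S_c}}) n : rel 'S_n := fun phi psi =>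
  [exists k : 'I_n.+1,
     [&& take k (one_line phi) == take k (one_line psi),
         drop (k + c) (one_line phi) == drop (k + c) (one_line psi)
       & same_part K (take c (drop k (one_line phi)))
                     (take c (drop k (one_line psi)))]].

Lemma size_one_line n (s : 'S_n) : size (one_line s) = n.
Proof. by rewrite size_map size_enum_ord. Qed.

Lemma same_part_sym c (K : {set {set 'S_c}}) : symmetric (same_part K).
Proof.
have imp u v : same_part K u v -> same_part K v u.
  case/exists_inP=> P PK /exists_inP[s sP /exists_inP[t tP /andP[us vt]]].
  apply/exists_inP; exists P => //; apply/exists_inP; exists t => //.
  by apply/exists_inP; exists s; rewrite // vt us.
by move=> u v; apply/idP/idP; apply: imp.
Qed.

Lemma K_stepP c (K : {set {set 'S_c}}) n (phi psi : 'S_n) :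
  reflect (exists a u v b : seq nat,
             [/\ one_line phi = a ++ u ++ b, one_line psi = a ++ v ++ b,
                 size u = c, size v = c & same_part K u v])
          (K_step K phi psi).
Proof.
apply: (iffP existsP) => [[k /and3P[/eqP ea /eqP eb uv]]|].
  exists (take k (one_line phi)), (take c (drop k (one_line phi))),
    (take c (drop k (one_line psi))), (drop (k + c) (one_line phi)).
  have [P _ /exists_inP[s _ /exists_inP[t _ /andP[]]]] := exists_inP uv.
  case/andP=> /eqP su _ /andP[/eqP sv _]; split=> //.
    by rewrite addnC -drop_drop !cat_take_drop.
  by rewrite ea eb addnC -drop_drop !cat_take_drop.
case=> a [u [v [b [ephi epsi su sv uv]]]].
have lt_a : size a < n.+1.
  by rewrite ltnS -(size_one_line phi) ephi size_cat leq_addr.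
exists (Ordinal lt_a); rewrite /= ephi epsi addnC -!drop_drop.
by rewrite !take_size_cat // !drop_size_cat // !take_size_cat // !eqxx.
Qed.

Lemma K_step_sym c (K : {set {set 'S_c}}) n : symmetric (@K_step c K n).
Proof.
move=> phi psi; apply: eq_existsb => k.
by rewrite same_part_sym (eq_sym (take k _)) (eq_sym (drop (k + c) _)).
Qed.

(* K_step is symmetric, so its reflexive transitive closure is the equivalence
   relation it generates. *)
Definition K_equiv c (K : {set {set 'S_c}}) n : rel 'S_n := connect (@K_step c K n).

Lemma K_equiv_equivalence c (K : {set {set 'S_c}}) n :
  equivalence_rel (@K_equiv c K n).
Proof.
apply/equivalence_relP; split=> [phi|phi psi e chi]; first exact: connect0.
exact: (same_connect (sym_connect_sym (@K_step_sym c K n)) e).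
Qed.

Definition num_K_classes c (K : {set {set 'S_c}}) (n : nat) : nat :=
  #|equivalence_partition (@K_equiv c K n) [set: 'S_n]|.

Definition part_of_words c (ws : seq (seq nat)) : {set 'S_c} :=
  [set s | one_line s \in ws].

Definition add_singletons c (Ps : {set {set 'S_c}}) : {set {set 'S_c}} :=
  Ps :|: [set [set s] | s in ~: cover Ps].

Definition K_123_321_132_213 : {set {set 'S_3}} :=
  add_singletons [set part_of_words 3 [:: [:: 1; 2; 3]; [:: 3; 2; 1]];
                      part_of_words 3 [:: [:: 1; 3; 2]; [:: 2; 1; 3]]].

Lemma add_singletons_partition c (Ps : {set {set 'S_c}}) :
  trivIset Ps -> set0 \notin Ps -> partition (add_singletons Ps) [set: 'S_c].
Proof.
move=> tI n0; apply/and3P; split.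
- apply/eqP/setP=> s; rewrite inE; apply/bigcupP.
  have [/bigcupP[P PP sP]|nc] := boolP (s \in cover Ps).
    by exists P; rewrite // inE PP.
  exists [set s]; last exact: set11.
  by rewrite inE; apply/orP; right; apply: imset_f; rewrite inE.
- apply/trivIsetP=> A B; rewrite !inE.
  have dis (P : {set 'S_c}) s : P \in Ps -> s \in ~: cover Ps -> [disjoint P & [set s]].
    move=> PP; rewrite inE disjoint_sym disjoints1; apply: contra => sP.
    by apply/bigcupP; exists P.
  case/orP=> [AP|/imsetP[s sc ->]] /orP[BP|/imsetP[t tc ->]] AB.
  + exact: (trivIsetP tI).
  + exact: dis.
  + by rewrite disjoint_sym; apply: dis.
  + by rewrite disjoints1 inE; apply: contraNneq AB => ->.
- rewrite inE negb_or n0 /=; apply/imsetP=> -[s _ /setP/(_ s)].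
  by rewrite !inE eqxx.
Qed.

Lemma K_123_321_132_213_partition :
  partition K_123_321_132_213 [set: 'S_3].
Proof.
have ol (s : 'S_3) : one_line s =
    [:: (s ord0).+1; (s (lift ord0 ord0)).+1; (s ord_max).+1].
  rewrite /one_line 3!enum_ordSl enum_ord0 /=.
  by congr [:: _; _; (val (s _)).+1]; apply: val_inj.
apply: add_singletons_partition.
  apply/trivIsetP=> A B; rewrite !inE.
  by do 2!case/orP=> /eqP->; rewrite ?eqxx // => _;
    rewrite -setI_eq0; apply/eqP/setP=> s; rewrite !inE;
    apply/negP=> /andP[/orP[]/eqP->].
rewrite !inE negb_or; apply/andP; split; apply/eqP=> /setP.
  by move/(_ 1%g); rewrite !inE ol !perm1.
by move/(_ (tperm ord0 (lift ord0 ord0))); rewrite !inE ol tpermL tpermR tpermD.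
Qed.

(* Main.v *)
Require Import Defs.
From mathcomp Require Import all_boot fingroup perm.
From mathcomp Require Import zify.

(** Permutations are handled as words of distinct natural numbers, and every
    class gets a canonical word of one of three kinds.

    - Skip-decreasing words: each letter exceeds the letter two places to its
      right. Such a word is determined by the set of letters in the places of
      odd rank, so there are as many as subsets of size [uphalf n].
    - Bracketed words [m :: M :: w], where [m] is the least letter, [M] the
      largest and [w] is skip-decreasing: these are counted by the same formula
      with [n - 2] letters.
    - The three standard words, which are increasing up to a rearrangement
      [abc], [acb] or [cab] of the last three letters.

    No two canonical words are equivalent. A word is tame if rewriting 123 into
    321 never produces a 132 or a 213. Skip-decreasing words are trivially tame,
    and a study of overlapping windows shows that the word before a rewriting
    step is tame if the word after it is. So only the moves 123 <-> 321 occur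
    in the class of a tame word; they fix the set of letters in odd places, and
    that set identifies the skip-decreasing word ([skip_dec_inj]). In the class
    of [m :: M :: w] the two extreme letters travel through [w] as a pair and
    may come apart only around a block of descents of [w], each of them
    reversed ([carries]); deleting them recovers a word equivalent to [w]
    ([carries_step]). Finally each move preserves the number of inversions
    modulo 3, which is 0, 1, 2 for the three standard words.

    Every word with at least five letters is equivalent to a canonical one
    ([classified_all]). For five and six letters this is a computation. For
    more letters, rewrite 123 into 321 as long as possible; if the result is not
    skip-decreasing, it has a window 132 or 213, and this window lies in the word
    deprived of its first or of its last letter. By induction that shorter word
    is equivalent to a standard or to a bracketed word, and adding one letter to
    either yields a word which is either equivalent to a standard word or again
    of the form [m :: M :: q] with [q] shorter. That a word with a standard
    factor of length at least five is itself equivalent to a standard word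
    ([standard_ext]) follows by induction from the case of one letter added to
    five. *)

Set Implicit Arguments.
Unset Strict Implicit.
Unset Printing Implicit Defensive.

(** * Words and moves *)

(** The move on a window: 123 <-> 321 and 132 <-> 213; the other windows (231,
    312) are left unchanged, so that at most one move applies to each window. *)
Definition flip (x y z : nat) : seq nat :=
  if (x < y < z) || (z < y < x) then [:: z; y; x]
  else if x < z < y then [:: z; x; y]
  else if y < x < z then [:: y; z; x]
  else [:: x; y; z].

(** One move inside a word. The window may be one that [flip] leaves unchanged;
    this does not affect the reflexive transitive closure [eqv]. *)
Definition step (p q : seq nat) : Prop :=
  exists a x y z b, p = a ++ [:: x, y, z & b] /\ q = a ++ flip x y z ++ b.

Inductive eqv (p : seq nat) : seq nat -> Prop :=
| eqv_refl : eqv p p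
| eqv_step q r : step p q -> eqv q r -> eqv p r.

Lemma perm_flip x y z : perm_eq (flip x y z) [:: x; y; z].
Proof.
rewrite /flip; case: ifP => _; first by rewrite -[[:: x; y; z]]revK perm_sym perm_rev.
case: ifP => _; first by rewrite (perm_catCA [:: z] [:: x; y] [::]) /=.
by case: ifP => _ //; rewrite (perm_catCA [:: y; z] [:: x] [::]) /=.
Qed.

Lemma flipK x y z : x != y -> y != z -> x != z ->
  exists x' y' z', flip x y z = [:: x'; y'; z'] /\ flip x' y' z' = [:: x; y; z].
Proof.
move=> xy yz xz; rewrite /flip.
case: ifP => [h1|h1].
  by exists z, y, x; split=> //; rewrite orbC h1.
case: ifP => [h2|h2].
  exists z, x, y; split=> //.
  do !(case: ifP => //=); lia.
case: ifP => [h3|h3].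
  exists y, z, x; split=> //.
  do !(case: ifP => //=); lia.
by exists x, y, z; split=> //; rewrite h1 h2 h3.
Qed.

Lemma step_perm p q : step p q -> perm_eq p q.
Proof.
case=> a [x [y [z [b [-> ->]]]]]; rewrite perm_cat2l perm_sym.
by rewrite -(cat1s x) -(cat1s y) -(cat1s z) !catA perm_cat2r perm_flip.
Qed.

Lemma eqv_perm p q : eqv p q -> perm_eq p q.
Proof. by elim=> // {}p' q' r /step_perm st _; apply: perm_trans. Qed.

Lemma eqv1 p q : step p q -> eqv p q.
Proof. by move=> st; apply: (eqv_step st); apply: eqv_refl. Qed.

Lemma eqv_trans p q r : eqv p q -> eqv q r -> eqv p r.
Proof. by elim=> // {}p q' r' st _ IH /IH; apply: eqv_step. Qed.

Lemma uniq_window (a : seq nat) x y z b : uniq (a ++ [:: x, y, z & b]) ->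
  [/\ x != y, y != z & x != z].
Proof.
rewrite cat_uniq /= !inE !negb_or => /and5P[_ _ /and3P[xy xz _] /andP[yz _] _].
by rewrite xy xz yz.
Qed.

Lemma step_sym p q : uniq p -> step p q -> step q p.
Proof.
move=> up [a [x [y [z [b [ep ->]]]]]]; rewrite ep in up *.
have [xy yz xz] := uniq_window up.
have [x' [y' [z' [e1 e2]]]] := flipK xy yz xz.
by exists a, x', y', z', b; rewrite e1 e2.
Qed.

Lemma eqv_sym p q : uniq p -> eqv p q -> eqv q p.
Proof.
move=> + pq; elim: pq => [{}p _|{}p q' r st _ IH up]; first exact: eqv_refl.
have uq : uniq q' by rewrite -(perm_uniq (step_perm st)).
by apply: (eqv_trans (IH uq)); apply: eqv1; apply: step_sym.
Qed.

Lemma step_ctx a b p q : step p q -> step (a ++ p ++ b) (a ++ q ++ b).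
Proof.
case=> a' [x [y [z [b' [-> ->]]]]].
by exists (a ++ a'), x, y, z, (b' ++ b); rewrite -!catA.
Qed.

Lemma eqv_ctx a b p q : eqv p q -> eqv (a ++ p ++ b) (a ++ q ++ b).
Proof.
elim=> [{}p|{}p q' r st _ IH]; first exact: eqv_refl.
by apply: (eqv_step _ IH); apply: step_ctx.
Qed.

Lemma eqv_cons x p q : eqv p q -> eqv (x :: p) (x :: q).
Proof. by move/(eqv_ctx [:: x] [::]); rewrite !cats0. Qed.

Lemma eqv_rcons x p q : eqv p q -> eqv (rcons p x) (rcons q x).
Proof. by rewrite -!cats1; apply: (eqv_ctx [::]). Qed.

Lemma eqv_uniq p q : eqv p q -> uniq p = uniq q.
Proof. by move/eqv_perm/perm_uniq. Qed.

Lemma eqv_size p q : eqv p q -> size p = size q.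
Proof. by move/eqv_perm/perm_size. Qed.

(** * Tame words *)

(** The rewriting of 123 into 321, oriented. *)
Definition up (p q : seq nat) : Prop :=
  exists a x y z b, [/\ x < y < z, p = a ++ [:: x, y, z & b] & q = a ++ [:: z, y, x & b]].

Inductive ups (p : seq nat) : seq nat -> Prop :=
| ups_refl : ups p p
| ups_step q r : up p q -> ups q r -> ups p r.

(** For words with distinct letters: no window has the pattern 132 or 213. *)
Definition mild (p : seq nat) : Prop :=
  forall a x y z b, p = a ++ [:: x, y, z & b] -> x < z -> x < y < z.

(** No window 132 or 213 ever appears by rewriting 123 into 321. *)
Definition tame (p : seq nat) : Prop := forall q, ups p q -> mild q.

Lemma tame_mild p : tame p -> mild p.
Proof. by apply; apply: ups_refl. Qed.

Lemma tame_up p q : tame p -> up p q -> tame q.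
Proof. by move=> tp pq r qr; apply: tp; apply: ups_step qr. Qed.

Lemma tame_mild_up p q : tame p -> up p q -> mild q.
Proof. by move=> tp pq; apply: tame_mild; apply: tame_up pq. Qed.

(** The sum of the products of each letter by the number of letters to its
    left; it decreases when 123 is rewritten into 321. *)
Fixpoint weight (s : seq nat) : nat :=
  if s is x :: s' then sumn s' + weight s' else 0.

Lemma weight_cat a b : weight (a ++ b) = weight a + size a * sumn b + weight b.
Proof. by elim: a => //= x a IH; rewrite IH sumn_cat; lia. Qed.

Lemma up_weight p q : up p q -> weight q < weight p.
Proof.
case=> a [x [y [z [b [xyz -> ->]]]]]; rewrite !weight_cat /=.
have -> : z + (y + (x + sumn b)) = x + (y + (z + sumn b)) by lia.
lia.
Qed.

Lemma up_flip p q : up p q -> step p q.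
Proof.
case=> a [x [y [z [b [xyz -> ->]]]]]; exists a, x, y, z, b; split=> //.
by rewrite /flip xyz.
Qed.

Lemma up_perm p q : up p q -> perm_eq p q.
Proof. by move/up_flip/step_perm. Qed.

Lemma up_uniq p q : up p q -> uniq p = uniq q.
Proof. by move/up_perm/perm_uniq. Qed.

Lemma cat_split (T : Type) (a a' b b' : seq T) : a ++ b = a' ++ b' ->
  (exists c, a' = a ++ c /\ b = c ++ b') \/ (exists c, a = a' ++ c /\ b' = c ++ b).
Proof.
elim: a a' => [|x a IH] [|x' a'] /=.
- by move=> ->; left; exists [::].
- by move=> ->; left; exists (x' :: a').
- by move=> <-; right; exists (x :: a).
case=> -> /IH[[c [-> ->]]|[c [-> ->]]]; [left|right]; exists c => //.
Qed.

Lemma up_at a x y z b : x < y < z -> up (a ++ [:: x, y, z & b]) (a ++ [:: z, y, x & b]).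
Proof. by move=> h; exists a, x, y, z, b. Qed.

(** The heart of the invariance of tameness: for each overlap of the rewritten
    window with another window, a 132 or 213 shows up after at most one more
    rewriting, and steps at disjoint windows commute, so that an induction on
    the weight applies. *)
Lemma tame_back p q : up p q -> tame q -> tame p.
Proof.
have [k] := ubnP (weight p); elim: k p q => // k IH p q /ltnSE wp pq tq.
have [a [x [y [z [b [xyz ep eq]]]]]] := pq.
have tq' := tame_mild_up tq.
have mq := tame_mild tq.
rewrite {}eq in pq tq tq' mq; rewrite {}ep in wp pq *.
have mp : mild (a ++ [:: x, y, z & b]).
  move=> a' x' y' z' b' e xz'.
  (* [c] is the offset of the two windows: they coincide, share two letters,
     share one letter, or are disjoint. *)
  case: (cat_split e) => -[c [ea eb]].
    case: c ea eb => [_ [<- <- <- _] //|c1 [|c2 [|c3 c]]] ea /=.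
    - move=> [_ ex ey eb]; rewrite eb in mq.
      have := mq (rcons a z) y x z' b'; rewrite cat_rcons => /(_ erefl); lia.
    - move=> [_ _ ez eb]; rewrite eb in mq tq'.
      have := mq (rcons a z) y x y' [:: z' & b']; rewrite cat_rcons => /(_ erefl).
      have := mq (a ++ [:: z; y]) x y' z' b'; rewrite -catA => /(_ erefl) h1 h2.
      have /(@up_at (a ++ [:: z; y]) x y' z' b') : x < y' < z' by lia.
      rewrite -!catA => /tq'/(_ a z y z' _ erefl); lia.
    - move=> [_ _ _ eb]; rewrite eb in mq.
      by apply: (mq (a ++ [:: z, y, x & c])) xz'; rewrite -catA.
  rewrite {}ea in mq tq'.
  case: c eb mq tq' => [[-> -> -> _] //|c1 [|c2 [|c3 c]]] /=; rewrite -?catA /=.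
  - move=> [ex' ey' ez' eb] mq tq'; rewrite -ex' in mq.
    by have := mq a' x' z y _ erefl; lia.
  - move=> [ex' ey' ez' eb] mq tq'; rewrite -ex' -ey' in mq tq'.
    have h1 := mq a' x' y' z _ erefl.
    have := mq (a' ++ [:: x']) y' z y [:: x & b]; rewrite -catA => /(_ erefl) h2.
    have /(@up_at a' x' y' z [:: y, x & b]) : x' < y' < z by lia.
    move/tq'/(_ (a' ++ [:: z; y']) x' y x b); rewrite -catA => /(_ erefl); lia.
  - move=> [ex' ey' ez' eb] mq tq'; apply: mq xz'.
    by rewrite ex' ey' ez'; congr (_ ++ _).
move=> r pr; case: pr mp => [//|q2 {}r pq2 + _]; move: r.
suff : tame q2 by [].
have wq2 := up_weight pq2.
have [a' [x' [y' [z' [b' [xyz' e eq2]]]]]] := pq2.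
suff [h|[r [qr q2r]]] : q2 = a ++ [:: z, y, x & b] \/
    exists r, up (a ++ [:: z, y, x & b]) r /\ up q2 r.
- by rewrite h.
- by apply: (IH q2 r) => //; [lia|apply: tame_up tq _].
rewrite {}eq2 in wq2 pq2 *.
case: (cat_split e) => -[c [ea eb]].
  rewrite {}ea {e} in pq2 wq2 *.
  case: c eb pq2 wq2 => [[-> -> -> ->] *|c1 [|c2 [|c3 c]]] /=.
  - by left; rewrite cats0.
  - move=> [_ ex ey eb] _ _; rewrite eb in mq.
    by have := mq (rcons a z) y x z' b'; rewrite cat_rcons => /(_ erefl); lia.
  - move=> [_ _ ez eb] _ _; rewrite eb in mq.
    have := mq (rcons a z) y x y' [:: z' & b']; rewrite cat_rcons => /(_ erefl).
    lia.
  - move=> [<- <- <- eb] _ _; right.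
    exists (a ++ [:: z, y, x & c] ++ [:: z', y', x' & b']); split.
      by rewrite eb; have := @up_at (a ++ [:: z, y, x & c]) x' y' z' b' xyz'; rewrite -!catA.
    by rewrite -!catA /=; apply: up_at.
rewrite {}ea {e} in mq pq2 wq2 tq' *.
case: c eb mq {tq' pq2 wq2} => [[-> -> -> ->]|c1 [|c2 [|c3 c]]] /=; rewrite -?catA /=.
- by left.
- move=> [ex' ey' ez' eb] mq; rewrite -ex' in mq.
  by have := mq a' x' z y _ erefl; lia.
- move=> [ex' ey' ez' eb] mq; rewrite -ex' -ey' in mq.
  have := mq (a' ++ [:: x']) y' z y [:: x & b]; rewrite -catA => /(_ erefl); lia.
- move=> [<- <- <- eb] mq; rewrite eb; right.
  exists (a' ++ [:: z', y', x' & c] ++ [:: z, y, x & b]); split; first exact: up_at.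
  by have := @up_at (a' ++ [:: z', y', x' & c]) x y z b xyz; rewrite -!catA.
Qed.

(** In the class of a tame word, only the moves 123 <-> 321 occur. *)
Lemma tame_step p q : tame p -> step p q -> [\/ up p q, up q p | p = q].
Proof.
move=> /tame_mild mp [a [x [y [z [b [ep ->]]]]]]; have := mp _ _ _ _ _ ep.
rewrite ep /flip => m.
case: ifP => [/orP[] h|_] /=.
- by constructor 1; apply: up_at.
- by constructor 2; apply: up_at.
case: ifP => [h|_] /=; first by lia.
case: ifP => [h|_] /=; first by lia.
by constructor 3.
Qed.

Lemma tame_eqv p q : eqv p q -> tame p -> tame q.
Proof.
elim=> // {}p q' r st _ IH tp; apply: IH.
case: (tame_step tp st) => [||<-] //; first exact: tame_up.
by move/tame_back; apply.
Qed.

(** The letters in the places of rank 1, 3, 5, ...; those in the even places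
    are [odds (behead s)]. *)
Fixpoint odds (s : seq nat) : seq nat :=
  if s is x :: s' then x :: (if s' is _ :: s'' then odds s'' else [::]) else [::].

Lemma seq2_ind (P : seq nat -> Prop) : P [::] -> (forall x, P [:: x]) ->
  (forall x y s, P s -> P (x :: y :: s)) -> forall s, P s.
Proof.
move=> P0 P1 P2 s; have [n] := ubnP (size s); elim: n s => // n IH [|x [|y s]] //= h.
by apply: P2; apply: IH; lia.
Qed.

Lemma perm_odds s : perm_eq (odds s ++ odds (behead s)) s.
Proof.
elim: s => //= x s IH; rewrite perm_cons; apply: perm_trans IH.
by case: s => //= y s; rewrite perm_catC /=.
Qed.

Lemma odds_inj s t : odds s = odds t -> odds (behead s) = odds (behead t) -> s = t.
Proof.
elim/seq2_ind: s t => [|x|x y s IH] [|x' [|y' t]] //=.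
by move=> [-> h1] [-> h2]; congr [:: _, _ & _]; apply: IH; case: s t h1 h2 => [|? ?] [|? ?].
Qed.

Lemma up_odds p q : up p q -> perm_eq (odds p) (odds q).
Proof.
case=> a [x [y [z [b [_ -> ->]]]]].
have sw (u v w : nat) s : perm_eq [:: u, v & s] [:: v, u & s].
  by rewrite (perm_catCA [:: u] [:: v]).
elim/seq2_ind: a => [|u|u v a IH] /=; last by rewrite perm_cons.
- exact: sw.
- by case: b.
Qed.

Lemma tame_odds p q : tame p -> eqv p q -> perm_eq (odds p) (odds q).
Proof.
move=> + e; elim: e => // {}p q' r st _ IH tp.
apply: perm_trans (IH (tame_eqv (eqv1 st) tp)).
by case: (tame_step tp st) => [/up_odds||<-//] // /up_odds; rewrite perm_sym.
Qed.

(** Skip-decreasing words: each letter exceeds the one two places further. *)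
Fixpoint skip_dec (s : seq nat) : bool :=
  if s is x :: s' then (if s' is _ :: z :: _ then z < x else true) && skip_dec s' else true.

Lemma skip_decP s : reflect (forall a x y z b, s = a ++ [:: x, y, z & b] -> z < x) (skip_dec s).
Proof.
apply: (iffP idP) => [d a|].
  elim: a s d => [|u a IH] s d x y z b e; rewrite {s}e /= in d; case/andP: d => // _ d.
  exact: IH d _ _ _ _ erefl.
elim: s => //= x s IH h; apply/andP; split; last first.
  by apply: IH => a x' y z b e; apply: (h (x :: a) x' y z b); rewrite e.
by case: s h {IH} => // y [|z b] // /(_ [::] x y z b); apply.
Qed.

Lemma skip_dec_tame p : skip_dec p -> tame p.
Proof.
move=> /skip_decP d q pq; case: pq d => [|q' r [a [x [y [z [b [xyz -> _]]]]]] _] d.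
  by move=> a x y z b /d; lia.
by have := d _ _ _ _ _ erefl; lia.
Qed.

Lemma skip_dec_odds p : skip_dec p -> sorted gtn (odds p).
Proof.
elim/seq2_ind: p => // x y [|z s] //= IH /and3P[xz yt d].
by rewrite xz; case: s IH yt d => [|t s] //= IH yt d; apply: IH; rewrite d; case: s {IH} d yt => //.
Qed.

Lemma skip_dec_inj p q : skip_dec p -> skip_dec q -> eqv p q -> p = q.
Proof.
move=> dp dq e; have po := tame_odds (skip_dec_tame dp) e.
have pe : perm_eq (odds (behead p)) (odds (behead q)).
  rewrite -(perm_cat2l (odds p)) (permPl (perm_odds p)).
  by rewrite (permPl (eqv_perm e)) perm_sym -(permPr (perm_odds q)) perm_cat2r.
have db s : skip_dec s -> skip_dec (behead s) by case: s => //= x s /andP[].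
have gt_tr : transitive gtn by move=> y x z /= yx zy; apply: ltn_trans zy yx.
have gt_asym : antisymmetric gtn by move=> x y /=; lia.
apply: odds_inj; apply: (sorted_eq gt_tr gt_asym) => //; apply: skip_dec_odds => //; exact: db.
Qed.

(** * Bracketed words *)

(** The word obtained by concatenating the pairs of [l]. *)
Definition down2 (l : seq (nat * nat)) : seq nat := flatten [seq [:: t.1; t.2] | t <- l].

(** The same word with each pair reversed. *)
Definition up2 (l : seq (nat * nat)) : seq nat := flatten [seq [:: t.2; t.1] | t <- l].

(** [y] is [w] with the letters [m] and [M] inserted around a factor of [w] that
    is cut into consecutive descents (possibly none), each of which is reversed.
    When [w] is tame and [m], [M] are the extreme letters, every word of the
    class of [m :: M :: w] has this form for some [w'] equivalent to [w]. *)
Definition carries (m M : nat) (w y : seq nat) : Prop :=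
  exists a l b, [/\ all (fun t => t.2 < t.1) l, w = a ++ down2 l ++ b
                  & y = a ++ m :: up2 l ++ M :: b].

Lemma mild_cat a p : mild (a ++ p) -> mild p.
Proof. by move=> h c x y z b e; apply: (h (a ++ c) x y z b); rewrite -catA e. Qed.

Lemma mild_cons x p : mild (x :: p) -> mild p.
Proof. exact: (@mild_cat [:: x]). Qed.

Lemma mild3 x y z b : mild [:: x, y, z & b] -> x < z -> x < y < z.
Proof. by move/(_ [::] x y z b erefl). Qed.

(** A move at a window to the right of [m]: it acts on the part after [M], or
    lets a descent pass across [M], in either direction; since the word without
    [m] and [M] is mild, no move is possible inside the block of reversed
    descents. *)
Lemma tail_step M l b s x y z b' :
  all (fun t => t.2 < t.1) l -> mild (down2 l ++ b) -> all (fun u => u < M) (down2 l ++ b) ->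
  uniq (down2 l ++ b) ->
  up2 l ++ M :: b = s ++ [:: x, y, z & b'] ->
  exists l2 b2, [/\ all (fun t => t.2 < t.1) l2,
     s ++ flip x y z ++ b' = up2 l2 ++ M :: b2 & eqv (down2 l ++ b) (down2 l2 ++ b2)].
Proof.
elim: l s => [|[y1 x1] l IH] s /=.
  move=> _ mb aM ub; case: s => [|c s] /=.
    case=> <- eb; rewrite {}eb /= in mb aM ub *.
    case/and3P: aM => yM zM _.
    rewrite /flip; case: ifP => [h|_].
      exists [:: (y, z)], b'; split=> //=; [by lia|exact: eqv_refl].
    case: ifP => [h|_]; first by lia.
    case: ifP => [h|_]; first by lia.
    by exists [::], [:: y, z & b']; split=> //; apply: eqv_refl.
  case=> <- ->; exists [::], (s ++ flip x y z ++ b'); split=> //=.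
  by apply: eqv1; exists s, x, y, z, b'.
move=> /andP[yx1 dl] mw /and3P[y1M x1M aM] /and3P[].
rewrite !inE !negb_or => /andP[_ y1w] x1w uw.
have frozen : flip x y z = [:: x; y; z] -> 
   [:: x1, y1 & up2 l ++ M :: b] = s ++ [:: x, y, z & b'] ->
   exists l2 b2, [/\ all (fun t => t.2 < t.1) l2,
     s ++ flip x y z ++ b' = up2 l2 ++ M :: b2 & eqv [:: y1, x1 & down2 l ++ b] (down2 l2 ++ b2)].
  move=> -> /= <-; exists ((y1, x1) :: l), b; split=> //=; first by rewrite yx1.
  exact: eqv_refl.
case: s frozen => [|c1 [|c2 s]] /=.
- move=> fr e; case: (e) => e1 e2 e3; subst x1 y1.
  case: l IH dl mw aM y1w x1w uw e e3 fr => [|[y2 x2] l] _ /=.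
    move=> _ mw aM y1w x1w uw _ [<- <-] _.
    exists [::], [:: y, x & b]; split=> //=; last exact: eqv_refl.
    by rewrite /flip yx1 y1M.
  move=> /andP[yx2 dl] mw aM _ _ _ e [e3 e4]; apply => //; subst x2.
  have := mild3 (mild_cons mw).
  by rewrite /flip; do !(case: ifP => // ?); lia.
- move=> fr e; case: (e) => e1 e2; subst x1 y1 => e3.
  case: l IH dl mw aM y1w x1w uw e e3 fr => [|[y2 x2] l] _ /=.
    move=> _ mw aM y1w x1w uw e [e3 e4] fr; apply: fr => //; subst y.
    rewrite e4 /= in mw aM.
    have := mild3 mw; case/andP: aM => zM _.
    by rewrite /flip; do !(case: ifP => // ?); lia.
  move=> /andP[yx2 dl] mw aM y1w x1w _ e [e3 e4 e5] fr; apply: fr => //; subst x2 y2.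
  have := mild3 mw; have := mild3 (mild_cons mw).
  move: y1w x1w; rewrite !inE !negb_or.
  by rewrite /flip; do !(case: ifP => // ?); lia.
- move=> _ [<- <-] e.
  have [] := IH s dl (mild_cons (mild_cons mw)) aM uw e.
  move=> l2 [b2 [dl2 -> ev]]; exists ((y1, x1) :: l2), b2; split=> //=.
    by rewrite yx1.
  by do 2!apply: eqv_cons.
Qed.

(** Moves on [y] amount to moves on [w] or leave [w] unchanged. *)
Lemma carries_step m M w y y' :
  tame w -> uniq w -> all (fun u => m < u < M) w ->
  carries m M w y -> step y y' -> exists2 w', eqv w w' & carries m M w' y'.
Proof.
move=> tw uw aw [a [l [b [dl ew ey]]]] [a' [x1 [x2 [x3 [b' [ey' ->]]]]]].
rewrite {}ey {y} in ey'.
have frozen : flip x1 x2 x3 = [:: x1; x2; x3] ->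
   exists2 w', eqv w w' & carries m M w' (a' ++ flip x1 x2 x3 ++ b').
  move=> ->; exists w; first exact: eqv_refl.
  by exists a, l, b; split.
have mw := tame_mild tw.
have inw u : u \in w -> m < u < M by move=> h; exact: (allP aw).
(* The window starts at [m]. *)
have same : a' = a -> exists2 w', eqv w w' & carries m M w' (a' ++ flip x1 x2 x3 ++ b').
  move=> ea; subst a'; have /eqP := ey'; rewrite eqseq_cat // eqxx => /eqP[e1 e2]; subst x1.
  case: l dl ew ey' e2 => [|[y0 x0] l] /=.
    move=> _ ew _ [e2 e3]; subst x2 b.
    exists w; first exact: eqv_refl.
    exists (rcons a x3), [::], b'; rewrite -!cats1 -!catA /=; split=> //=.
    have /inw h : x3 \in w by rewrite ew !(mem_cat, inE) eqxx ?orbT.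
    by congr (_ ++ _); rewrite /flip; do !(case: ifP => //= ?); lia.
  move=> /andP[yx dl] ew _ [e2 e3 e4]; subst x2 x3 b'.
  exists w; first exact: eqv_refl.
  exists (a ++ [:: y0; x0]), l, b; rewrite -!catA /=; split=> //=.
  have /inw h : x0 \in w by rewrite ew !(mem_cat, inE) eqxx ?orbT.
  have /inw h2 : y0 \in w by rewrite ew !(mem_cat, inE) eqxx ?orbT.
  by congr (_ ++ _); rewrite /flip; do !(case: ifP => //= ?); lia.
case: (cat_split ey') => -[c [ea eb]].
  case: c ea eb => [|c0 c] ea; first by move=> _; apply: same; rewrite ea cats0.
  rewrite /= => -[e1 e2]; subst c0.
  have mt : mild (down2 l ++ b) by rewrite ew in mw; apply: mild_cat mw.
  have at' : all (fun u => u < M) (down2 l ++ b).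
    apply/allP => u h; have /(allP aw)/andP[] // : u \in w.
    by rewrite ew mem_cat h orbT.
  have ut : uniq (down2 l ++ b) by move: uw; rewrite ew cat_uniq => /and3P[].
  have [l2 [b2 [dl2 e3 ev]]] := tail_step dl mt at' ut e2.
  exists (a ++ down2 l2 ++ b2).
    rewrite ew; have := eqv_ctx a [::] ev; by rewrite !cats0.
  by exists a, l2, b2; split=> //; rewrite ea -catA /= e3.
case: c ea eb => [|c1 [|c2 [|c3 c]]] ea /=.
- by move=> _; apply: same; rewrite ea cats0.
all: clear same ey'; subst a; rewrite -catA /= in ew.
- case=> e1 e2 e3; subst x1 x2.
  have /inw h1 : c1 \in w by rewrite ew !(mem_cat, inE) eqxx ?orbT.
  case: l dl e3 ew => [|[y0 x0] l] /=.
    move=> _ [e3 e4] ew; subst x3 b'.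
    exists w; first exact: eqv_refl.
    exists a', [::], (c1 :: b); rewrite -?catA /=; split=> //=.
    by congr (_ ++ _); rewrite /flip; do !(case: ifP => //= ?); lia.
  move=> /andP[yx dl] [e3 e4] ew; subst x3; apply: frozen.
  rewrite ew in mw; have := mild3 (mild_cat mw).
  have /inw h2 : x0 \in w by rewrite ew !(mem_cat, inE) eqxx ?orbT.
  have /inw h3 : y0 \in w by rewrite ew !(mem_cat, inE) eqxx ?orbT.
  rewrite ew in uw; have := uniq_window uw.
  by rewrite /flip => -[]; do !(case: ifP => // ?); lia.
- case=> e1 e2 e3 e4; subst x1 x2 x3 b'.
  have /inw h1 : c1 \in w by rewrite ew !(mem_cat, inE) eqxx ?orbT.
  have /inw h2 : c2 \in w by rewrite ew !(mem_cat, inE) eqxx ?orbT.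
  have [h|h] := ltnP c2 c1.
    exists w; first exact: eqv_refl.
    exists a', ((c1, c2) :: l), b; split=> //=; first by rewrite h dl.
    by congr (_ ++ _); rewrite /flip; do !(case: ifP => //= ?); lia.
  have : c1 != c2 by move: uw; rewrite ew cat_uniq => /and3P[_ _] /=; rewrite inE negb_or => /andP[/andP[]].
  move=> h3; apply: frozen.
  by rewrite /flip; do !(case: ifP => //= ?); lia.
- case=> e1 e2 e3 e4; subst x1 x2 x3 b'.
  exists (a' ++ flip c1 c2 c3 ++ c ++ down2 l ++ b).
    by rewrite ew; apply: eqv1; exists a', c1, c2, c3, (c ++ down2 l ++ b).
  by exists (a' ++ flip c1 c2 c3 ++ c), l, b; rewrite -!catA.
Qed.

(** * Standard words *)

(** The word [s] with its last three letters [abc] rearranged as [abc], [acb] or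
    [cab] for [k] equal to 0, 1 or at least 2. *)
Fixpoint std (k : nat) (s : seq nat) : seq nat :=
  match s with
  | [:: a; b; c] =>
      match k with 0 => [:: a; b; c] | 1 => [:: a; c; b] | _ => [:: c; a; b] end
  | x :: s' => x :: std k s'
  | [::] => [::]
  end.

Lemma std_cons k x s : 2 < size s -> std k (x :: s) = x :: std k s.
Proof. by case: s => [|? [|? [|? ?]]]. Qed.

Lemma std_short k s : size s < 3 -> std k s = s.
Proof. by case: s => [|? [|? [|? ?]]]. Qed.

Lemma std_ind (P : seq nat -> Prop) : (forall s, size s < 3 -> P s) ->
  (forall a b c, P [:: a; b; c]) -> (forall x s, 2 < size s -> P s -> P (x :: s)) ->
  forall s, P s.
Proof.
move=> P0 P3 PS; elim=> [|x s IH]; first exact: P0.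
case: (ltnP 2 (size s)) => h; first exact: PS.
by case: s h {IH} => [|y [|z [|? ?]]] // _; (exact: P0 || exact: P3).
Qed.

Lemma perm_std k s : perm_eq (std k s) s.
Proof.
elim/std_ind: s => [s h|a b c|x s h IH]; first by rewrite std_short.
  case: k => [|[|k]] //=; rewrite ?perm_cons.
    by rewrite (perm_catCA [:: c] [:: b] [::]).
  by rewrite (perm_catCA [:: c] [:: a; b] [::]).
by rewrite std_cons // perm_cons.
Qed.

Lemma map_std f k s : map f (std k s) = std k (map f s).
Proof.
elim/std_ind: s => [s h|a b c|x s h IH]; first by rewrite !std_short ?size_map.
  by case: k => [|[|k]].
by rewrite std_cons // !map_cons IH std_cons ?size_map.
Qed.

(** A standard word deprived of its last letter is standard, and that letter is
    not the least one. *)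
Lemma std_rcons k s : sorted ltn s -> 3 < size s ->
  exists k' s' b, [/\ std k s = rcons (std k' s') b, sorted ltn s' & exists2 c, c \in s' & c < b].
Proof.
elim/std_ind: s => [s h _ h'|a b c _ //|x s h IH so _]; first by lia.
have := IH (path_sorted so).
case: (ltnP 3 (size s)) => [s4 /(_ isT)|s3 _].
  case=> k' [s' [b [e so' [c cs cb]]]]; exists k', (x :: s'), b; split.
  - rewrite std_cons // e [in RHS]std_cons //.
    have := congr1 size e; rewrite size_rcons !(perm_size (perm_std _ _)) => ee; by move: s4; rewrite ee.
  - rewrite /= path_min_sorted //; apply/allP => u us.
    have : u \in s.
      rewrite -(perm_mem (perm_std k s)) e mem_rcons inE (perm_mem (perm_std _ _)) us orbT //.
    by have /allP/(_ u) := order_path_min ltn_trans so; apply.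
  - by exists c; rewrite // inE cs orbT.
case: s h so s3 {IH} => [|a [|b [|c [|? ?]]]] //= _ /and4P[xa ab bc _] _.
case: k => [|[|k]] /=.
- by exists 0, [:: x; a; b], c; split=> //=; [lia|exists a; rewrite ?inE ?eqxx ?orbT; lia].
- exists 0, [:: x; a; c], b; split=> //=; [lia|exists a; rewrite ?inE ?eqxx ?orbT; lia].
- exists 1, [:: x; a; c], b; split=> //=; [lia|exists a; rewrite ?inE ?eqxx ?orbT; lia].
Qed.

(** * Relabelling and computation of classes *)

Lemma flip_map (f : nat -> nat) x y z :
  {in [:: x; y; z] &, {mono f : u v / u < v}} ->
  flip (f x) (f y) (f z) = map f (flip x y z).
Proof.
move=> fm; rewrite /flip !fm ?inE ?eqxx ?orbT //.
by do !case: ifP.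
Qed.

Lemma eqv_map (f : nat -> nat) p q :
  {in p &, {mono f : u v / u < v}} -> eqv p q -> eqv (map f p) (map f q).
Proof.
move=> + e; elim: e => [{}p _|{}p q' r st _ IH fm]; first exact: eqv_refl.
have fm' : {in q' &, {mono f : u v / u < v}}.
  by move=> u v uq vq; apply: fm; rewrite (perm_mem (step_perm st)).
apply: eqv_step (IH fm').
case: st fm {fm' IH} => a [x [y [z [b [-> ->]]]]] fm.
exists (map f a), (f x), (f y), (f z), (map f b); rewrite !map_cat; split=> //.
by rewrite flip_map // => u v hu hv; apply: fm;
  rewrite mem_cat -(cat1s x) -(cat1s y) -(cat1s z) !catA mem_cat -!catA ?hu ?hv ?orbT.
Qed.

Lemma nth_mono s : sorted ltn s -> {in [pred i | i < size s] &, {mono nth 0 s : i j / i < j}}.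
Proof.
move=> so i j; rewrite !inE => hi hj; case: (ltngtP i j) => [ij|ij|->]; last by rewrite ltnn.
  exact: (sorted_ltn_nth ltn_trans).
have : nth 0 s j < nth 0 s i by apply: (sorted_ltn_nth ltn_trans).
lia.
Qed.

(** The words one move away. *)
Fixpoint nbrs (p : seq nat) : seq (seq nat) :=
  if p is x :: ((y :: z :: b) as t) then (flip x y z ++ b) :: map (cons x) (nbrs t)
  else [::].

Lemma nbrs_step p q : q \in nbrs p -> step p q.
Proof.
elim: p q => //= x [|y [|z b]] // IH q; rewrite inE => /orP[/eqP->|/mapP[t tin ->]].
  by exists [::], x, y, z, b.
by have := step_ctx [:: x] [::] (IH _ tin); rewrite !cats0.
Qed.

(** Breadth-first search with fuel [n], from the words of [front]. Only its
    soundness is proved; the computations below check that it reaches enough. *)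
Fixpoint bfs n (seen front : seq (seq nat)) : seq (seq nat) :=
  if n is n'.+1 then
    let new := [seq q <- undup (flatten (map nbrs front)) | q \notin seen] in
    bfs n' (new ++ seen) new
  else seen.

Lemma bfs_eqv p q n seen front : (forall u, u \in seen -> eqv p u) ->
  (forall u, u \in front -> eqv p u) -> q \in bfs n seen front -> eqv p q.
Proof.
elim: n seen front => [|n IH] seen front hs hf /=; first exact: hs.
have hn u : u \in [seq q <- undup (flatten (map nbrs front)) | q \notin seen] -> eqv p u.
  rewrite mem_filter mem_undup => /andP[_ /flattenP[l /mapP[v vf ->] /nbrs_step st]].
  by apply: eqv_trans (hf v vf) (eqv1 st).
by apply: IH => // u; rewrite mem_cat => /orP[/hn|/hs].
Qed.

(* A fuel of 40 is ample for the classes on at most six letters. *)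
Definition class_of p := bfs 40 [:: p] [:: p].

Lemma class_of_eqv p q : q \in class_of p -> eqv p q.
Proof. by apply: bfs_eqv => u; rewrite inE => /eqP->; apply: eqv_refl. Qed.

(** Equivalence to a standard word. *)
Definition standard (p : seq nat) : Prop := exists k s, sorted ltn s /\ eqv p (std k s).

Lemma eqv_standard p q : eqv p q -> standard q -> standard p.
Proof. by move=> pq [k [s [so e]]]; exists k, s; split=> //; apply: eqv_trans e. Qed.

Lemma standard_map k s p0 : sorted ltn s -> p0 \in class_of (std k (iota 0 (size s))) ->
  standard (map (nth 0 s) p0).
Proof.
move=> so /class_of_eqv e; exists k, s; split=> //.
have pm : perm_eq p0 (iota 0 (size s)).
  by apply: perm_trans (perm_std k _); rewrite perm_sym eqv_perm.
have -> : std k s = map (nth 0 s) (std k (iota 0 (size s))).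
  by rewrite map_std map_nth_iota0 // take_size.
apply: eqv_map.
  move=> i j; rewrite !(perm_mem pm) !mem_iota /= !add0n => hi hj.
  by apply: nth_mono.
apply: eqv_sym e; rewrite (perm_uniq (perm_std _ _)); exact: iota_uniq.
Qed.

(** The classes of the three standard words on the letters 0, ..., n - 1. *)
Definition std_classes n := flatten [seq class_of (std k (iota 0 n)) | k <- [:: 0; 1; 2]].

Lemma standard_words s p0 : sorted ltn s -> p0 \in std_classes (size s) -> standard (map (nth 0 s) p0).
Proof.
rewrite /std_classes => so /flattenP[l /mapP[k _ el] p0l]; rewrite el in p0l.
exact: standard_map so p0l.
Qed.

(** The five-letter words that occur when a letter is added to a bracketed word,
    and at the start of a bracketed word inside another pair of brackets. *)
Lemma std_classes5 : all (fun p => p \in std_classes 5)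
 [:: [:: 0;1;4;2;3]; [:: 0;1;4;3;2]; [:: 4;0;3;1;2]; [:: 4;0;3;2;1];
     [:: 0; 4; 1; 3; 2]; [:: 2;3;1;4;0]; [:: 3;2;1;4;0]; [:: 1;2;0;3;4]; [:: 2;1;0;3;4]].
Proof. by vm_compute. Qed.

(** The words obtained by adding a letter at either end of a standard word on
    five letters; [bump i] makes room for the letter [i]. *)
Definition insertions := 
 [seq rcons (map (bump i) (std k (iota 0 5))) i | i <- iota 0 6, k <- [:: 0; 1; 2]]
 ++ [seq i :: (map (bump i) (std k (iota 0 5))) | i <- iota 0 6, k <- [:: 0; 1; 2]].

Lemma insertions_standard : let B := std_classes 6 in all (fun p => p \in B) insertions.
Proof. by vm_compute. Qed.

(** The words [m :: M :: w] with [w] nonempty and skip-decreasing, and all its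
    letters strictly between [m] and [M]. *)
Definition bracketed (p : seq nat) : bool :=
  if p is m :: M :: w then [&& w != [::], all (fun u => m < u < M) w & skip_dec w] else false.

Definition canonical_word n p := [|| skip_dec p, bracketed p | p \in [seq std k (iota 0 n) | k <- [:: 0; 1; 2]]].

(** Each permutation of [n] letters is in the class of a canonical word. *)
Definition classes_cover n :=
  let P := permutations (iota 0 n) in
  let R := flatten [seq class_of c | c <- P & canonical_word n c] in
  all (fun p => p \in R) P.

Lemma classes_cover5 : classes_cover 5. Proof. by vm_compute. Qed.
Lemma classes_cover6 : classes_cover 6. Proof. by vm_compute. Qed.

Lemma size_eqv_std k s p : eqv p (std k s) -> size p = size s.
Proof. by move/eqv_size ->; apply: perm_size; apply: perm_std. Qed.

Lemma standard_std k s : sorted ltn s -> standard (std k s).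
Proof. by move=> so; exists k, s; split=> //; apply: eqv_refl. Qed.

(** * Extending standard words *)

Lemma standard_cons_min c q : 2 < size q -> all (ltn c) q -> standard q -> standard (c :: q).
Proof.
move=> sq cq [k [s [so e]]]; exists k, (c :: s).
have ps : perm_eq q s by apply: perm_trans (eqv_perm e) (perm_std _ _).
split; last by rewrite std_cons -?(perm_size ps) //; apply: eqv_cons.
by rewrite /= path_min_sorted // -(perm_all _ ps).
Qed.

Lemma split_sorted a s : sorted ltn s -> a \notin s ->
  exists s1 s2, s = s1 ++ s2 /\ sorted ltn (s1 ++ a :: s2).
Proof.
elim: s => [|x s IH] so; first by exists [::], [::].
rewrite inE negb_or => /andP[ax /(IH (path_sorted so))[s1 [s2 [es so2]]]].
have [lt_ax|le_xa] := ltnP a x.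
  by exists [::], (x :: s); split=> //=; rewrite lt_ax.
exists (x :: s1), s2; rewrite es; split=> //=.
rewrite path_min_sorted //.
have := order_path_min ltn_trans so; rewrite es !all_cat /= => /andP[-> ->].
lia.
Qed.

Lemma std_le2 k s : exists2 k', k' \in [:: 0; 1; 2] & std k s = std k' s.
Proof.
case: k => [|[|k]]; [by exists 0|by exists 1|exists 2 => //].
elim/std_ind: s => [s h|a b c|x s h IH]; first by rewrite !std_short.
  by [].
by rewrite !std_cons // IH.
Qed.

(** One letter added to five; the letter is placed among the sorted letters of
    the word, then the computed list applies. *)
Lemma standard_base q a : size q = 5 -> standard q -> uniq (a :: q) -> standard (a :: q) /\ standard (rcons q a).
Proof.
move=> sq [k0 [s [so e]]] /= /andP[aq uq].
have ss : size s = 5 by rewrite -sq (size_eqv_std e).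
have [k kin ek] := std_le2 k0 s; rewrite ek in e.
have as' : a \notin s by rewrite -(perm_mem (perm_std k s)) -(perm_mem (eqv_perm e)).
have [s1 [s2 [es so2]]] := split_sorted so as'.
have sz : size (s1 ++ a :: s2) = 6 by rewrite size_cat /= addnS -size_cat -es ss.
have na : a = nth 0 (s1 ++ a :: s2) (size s1) by rewrite nth_cat ltnn subnn.
have estd : std k s = map (nth 0 (s1 ++ a :: s2)) (map (bump (size s1)) (std k (iota 0 5))).
  rewrite -map_comp.
  have {1}-> : s = map (nth 0 s) (iota 0 5) by rewrite map_nth_iota0 ?ss // take_oversize ?ss.
  rewrite -map_std; apply: eq_map => j /=.
  rewrite es !nth_cat /bump; case: (ltnP j (size s1)) => h.
    by rewrite add0n h.
  by rewrite ltnNge (leq_trans h) //= add1n subSn.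
have i6 : size s1 \in iota 0 6 by rewrite mem_iota /= add0n -sz size_cat /=; lia.
have /allP ins := insertions_standard.
split.
- apply: eqv_standard (eqv_cons a e) _.
  rewrite [in a :: _]na estd -map_cons; apply: standard_words => //; rewrite sz.
  apply: ins; rewrite mem_cat; apply/orP; right.
  by apply/allpairsP; exists (size s1, k).
- apply: eqv_standard (eqv_rcons a e) _.
  rewrite [in rcons _ a]na estd -map_rcons; apply: standard_words => //; rewrite sz.
  apply: ins; rewrite mem_cat; apply/orP; left.
  by apply/allpairsP; exists (size s1, k).
Qed.

(** One letter added to a standard word, at either end. For a letter [a] in
    front of [q], split off the last letter [b] of [q], put the rest in standard
    form and split off its first letter, which is then the least of all. *)
Lemma standard_ext n q a : 4 < n -> size q = n -> standard q -> uniq (a :: q) ->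
  standard (a :: q) /\ standard (rcons q a).
Proof.
elim: n q a => // n IH q a; rewrite ltnS leq_eqVlt => /orP[/eqP<-|n4]; first exact: standard_base.
have SC q' a' : size q' = n.+1 -> standard q' -> uniq (a' :: q') -> standard (a' :: q').
  move=> sq [k [s [so e]]] uaq.
  have ss : size s = n.+1 by rewrite -sq (size_eqv_std e).
  have s3 : 3 < size s by lia.
  have [k' [s' [b [es so' [c cs cb]]]]] := std_rcons k so s3.
  have ss' : size (std k' s') = n.
    by have := congr1 size es; rewrite size_rcons (perm_size (perm_std _ _)) ss => -[].
  have e1 := eqv_cons a' e.
  have u1 : uniq (a' :: std k' s').
    by move: uaq; rewrite (eqv_uniq e1) es -rcons_cons rcons_uniq => /andP[].
  have [[k2 [s2 [so2 e2]]] _] := IH _ a' n4 ss' (standard_std _ so') u1.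
  have ss2 := size_eqv_std e2; rewrite /= ss' in ss2.
  have mem2 u : (u \in s2) = (u \in a' :: s').
    rewrite -(perm_mem (perm_std k2 s2)) -(perm_mem (eqv_perm e2)) !inE.
    by rewrite (perm_mem (perm_std _ _)).
  case: s2 so2 e2 ss2 mem2 => // c2 s2 so2 e2 [ss2] mem2.
  have e3 : eqv (a' :: q') (c2 :: rcons (std k2 s2) b).
    apply: eqv_trans e1 _; rewrite es -!rcons_cons; apply: eqv_rcons.
    by rewrite std_cons -?ss2 in e2; last lia.
  apply: (eqv_standard e3).
  have u3 : uniq (b :: std k2 s2).
    by move: uaq; rewrite (eqv_uniq e3) /= rcons_uniq => /andP[].
  have ss3 : size (std k2 s2) = n by rewrite (perm_size (perm_std _ _)).
  have [_ St] := IH _ b n4 ss3 (standard_std _ (path_sorted so2)) u3.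
  apply: standard_cons_min => //; first by rewrite size_rcons ss3; lia.
  have c2s := order_path_min ltn_trans so2.
  rewrite all_rcons (perm_all _ (perm_std _ _)) c2s andbT /=.
  have : c \in c2 :: s2 by rewrite mem2 inE cs orbT.
  by rewrite inE => /orP[/eqP<-//|/(allP c2s) /= h]; lia.
move=> sq Sq uaq; split; first exact: SC.
case: Sq => k [s [so e]].
have ss : size s = n.+1 by rewrite -sq (size_eqv_std e).
have e1 := eqv_rcons a e.
have u1 : uniq (rcons (std k s) a) by rewrite -(eqv_uniq e1) rcons_uniq.
case: s so e ss e1 u1 => // c s so e [ss] e1.
rewrite std_cons ?rcons_cons in e1 *; last lia.
rewrite cons_uniq => u1.
have u2 : uniq (a :: std k s) by case/andP: u1; rewrite rcons_uniq.
have ss2 : size (std k s) = n by rewrite (perm_size (perm_std _ _)).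
apply: (eqv_standard e1); apply: SC => //; first by rewrite size_rcons ss2.
by have [] := IH _ a n4 ss2 (standard_std _ (path_sorted so)) u2.
Qed.

Lemma standard_catr q r : 4 < size q -> standard q -> uniq (q ++ r) -> standard (q ++ r).
Proof.
elim: r q => [|a r IH] q sq Sq uq; first by rewrite cats0.
rewrite -cat_rcons; apply: IH; rewrite ?size_rcons ?cat_rcons //; first lia.
have [] := standard_ext (a := a) sq erefl Sq _ => //.
by move: uq; rewrite -cat_rcons cat_uniq rcons_uniq => /andP[].
Qed.

Lemma standard_catl q r : 4 < size q -> standard q -> uniq (r ++ q) -> standard (r ++ q).
Proof.
move=> sq Sq; elim: r => //= a r IH /andP[ar ur].
have [] := standard_ext (a := a) (_ : 4 < size (r ++ q)) erefl (IH ur) _ => //.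
- by rewrite size_cat; lia.
- by rewrite /= ar ur.
Qed.

(** * Every word is equivalent to a canonical word *)

(** Equivalence to a canonical word. *)
Definition classified p : Prop := exists2 q, eqv p q & [\/ skip_dec q, bracketed q | standard q].

Lemma eqv_classified p q : eqv p q -> classified q -> classified p.
Proof. by move=> pq [r qr h]; exists r => //; apply: eqv_trans qr. Qed.

Lemma standard_classified p : standard p -> classified p.
Proof. by exists p; [exact: eqv_refl|constructor 3]. Qed.

(** Each word with distinct letters is a relabelled permutation of an initial
    segment. *)
Lemma word_map u : uniq u -> exists s p, [/\ sorted ltn s, size s = size u,
   perm_eq p (iota 0 (size u)) & u = map (nth 0 s) p].
Proof.
move=> uu; exists (sort leq u), (map (index^~ (sort leq u)) u); split.
- by rewrite ltn_sorted_uniq_leq sort_uniq uu sort_sorted //; exact: leq_total.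
- by rewrite size_sort.
- have -> : iota 0 (size u) = map (index^~ (sort leq u)) (sort leq u).
    apply: (@eq_from_nth _ 0); first by rewrite size_map size_iota size_sort.
    move=> i; rewrite size_iota => hi; rewrite nth_iota // (nth_map 0) ?size_sort //.
    by rewrite index_uniq ?size_sort ?sort_uniq.
  by apply: perm_map; rewrite perm_sym perm_sort.
- rewrite -map_comp -[LHS]map_id; apply/eq_in_map => x xu /=.
  by rewrite nth_index // mem_sort.
Qed.

Lemma skip_dec_map (f : nat -> nat) p : {in p &, {mono f : u v / u < v}} -> skip_dec p -> skip_dec (map f p).
Proof.
elim: p => //= x [|y [|z s]] //= IH fm /andP[zx d]; apply/andP; split.
  by rewrite fm ?inE ?eqxx ?orbT.
by apply: IH => // u v hu hv; apply: fm; rewrite inE ?hu ?hv orbT.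
Qed.

Lemma classified_small n u : classes_cover n -> size u = n -> uniq u -> classified u.
Proof.
move=> tc su uu; have [s [p [so ss pp ->]]] := word_map uu.
rewrite su in ss pp.
have : p \in flatten [seq class_of c | c <- permutations (iota 0 n) & canonical_word n c].
  by apply: (allP tc); rewrite mem_permutations.
case/flattenP=> l /mapP[c]; rewrite mem_filter mem_permutations => /andP[cc pc] -> /class_of_eqv e.
have fm : {in iota 0 n &, {mono nth 0 s : u v / u < v}}.
  move=> i j; rewrite !mem_iota !add0n /= -ss => hi hj; exact: nth_mono.
have fmc : {in c &, {mono nth 0 s : u v / u < v}}.
  by move=> i j hi hj; apply: fm; rewrite -(perm_mem pc).
have uc : uniq c by rewrite (perm_uniq pc) iota_uniq.
exists (map (nth 0 s) c).
  apply: eqv_map; last exact: eqv_sym.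
  by move=> i j hi hj; apply: fm; rewrite -(perm_mem pp).
case/or3P: cc => [h|h|/mapP[k _ ->]].
- by constructor 1; apply: skip_dec_map.
- constructor 2.
  case: c h {e pc uc} fmc => // m [|M w] //= /and3P[w0 aw dw] fmc; apply/and3P; split.
  + by case: w w0 {aw dw fmc}.
  + apply/allP => _ /mapP[v vw ->]; have /andP[h1 h2] := allP aw v vw.
    by rewrite !fmc ?inE ?eqxx ?vw ?orbT // h1 h2.
  + by apply: skip_dec_map => // i j hi hj; apply: fmc; rewrite !inE ?hi ?hj ?orbT.
- by constructor 3; rewrite map_std map_nth_iota0 -?ss ?take_size; [exact: standard_std|].
Qed.

Lemma skip_decN p : uniq p -> ~~ skip_dec p -> exists a x y z b, p = a ++ [:: x, y, z & b] /\ x < z.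
Proof.
elim: p => // x p IH /= /andP[xp up']; rewrite negb_and => /orP[|/IH[]//].
  case: p xp {IH up'} => [|y [|z b]] //=; rewrite !inE !negb_or => /and3P[_ xz _] zx.
  by exists [::], x, y, z, b; split=> //; lia.
by move=> a [x' [y [z [b [-> h]]]]]; exists (x :: a), x', y, z, b.
Qed.

(** Rewriting 123 into 321 as long as possible gives a skip-decreasing word or
    a word with a window 132 or 213. *)
Lemma normal_up p : uniq p -> exists2 q, eqv p q &
  skip_dec q \/ exists a x y z b, [/\ q = a ++ [:: x, y, z & b], x < z & ~~ (x < y < z)].
Proof.
have [k] := ubnP (weight p); elim: k p => // k IH p /ltnSE wp Up.
have [d|nd] := boolP (skip_dec p); first by exists p; [exact: eqv_refl|left].
have [a [x [y [z [b [ep xz]]]]]] := skip_decN Up nd.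
have [xyz|nxyz] := boolP (x < y < z).
  have U : up p (a ++ [:: z, y, x & b]) by rewrite ep; apply: up_at.
  have [||q eq hq] := IH (a ++ [:: z, y, x & b]).
  - by have := up_weight U; lia.
  - by rewrite -(up_uniq U).
  by exists q => //; apply: eqv_step (up_flip U) eq.
by exists p; [exact: eqv_refl|right; exists a, x, y, z, b].
Qed.

(** Skip-decreasing words being tame, they are not equivalent to a word with a
    window 132 or 213. *)
Lemma wild_not_skip_dec a x y z b q : x < z -> ~~ (x < y < z) ->
  let p := a ++ [:: x, y, z & b] in uniq p -> eqv p q -> ~~ skip_dec q.
Proof.
move=> xz nxyz p Up pq; apply/negP => /skip_dec_tame/(tame_eqv (eqv_sym Up pq))/tame_mild.
by move/(_ _ _ _ _ _ erefl xz); apply/negP.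
Qed.

Lemma standard5 s p0 : size s = 5 -> sorted ltn s ->
  p0 \in [:: [:: 0;1;4;2;3]; [:: 0;1;4;3;2]; [:: 4;0;3;1;2]; [:: 4;0;3;2;1];
     [:: 0; 4; 1; 3; 2]; [:: 2;3;1;4;0]; [:: 3;2;1;4;0]; [:: 1;2;0;3;4]; [:: 2;1;0;3;4]] ->
  standard (map (nth 0 s) p0).
Proof.
move=> ss so h; apply: standard_words => //; rewrite ss.
exact: (allP std_classes5).
Qed.

(** The pair of extreme letters travels through the word. *)
Lemma pair_move m M w : all (fun u => m < u < M) w -> eqv (m :: M :: w) (w ++ [:: m; M]).
Proof.
elim: w => [|x w IH] /=; first by move=> _; apply: eqv_refl.
case/andP=> h /IH e; apply: (@eqv_step _ (x :: m :: M :: w)); last exact: eqv_cons.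
exists [::], m, M, x, w; split=> //=.
by rewrite /flip; do !(case: ifP => //= ?); lia.
Qed.

(** A pair of extreme letters in front of a word for which the claim holds. *)
Lemma classified_mid m M q : 4 < size q -> all (fun u => m < u < M) q -> uniq (m :: M :: q) ->
  classified q -> classified (m :: M :: q).
Proof.
move=> sq aq umq [r e h]; have e2 := eqv_cons m (eqv_cons M e).
have umr : uniq (m :: M :: r) by rewrite -(eqv_uniq e2).
have sr : 4 < size r by rewrite -(eqv_size e).
have ar : all (fun u => m < u < M) r by rewrite -(perm_all _ (eqv_perm e)).
apply: (eqv_classified e2); case: h => [d|c|S].
- exists (m :: M :: r); [exact: eqv_refl|constructor 2].
  by rewrite /= d ar; case: r sr {umr ar d e e2}.
- apply: standard_classified; clear e e2; case: r c sr ar umr => // m' [|M' [|x r]] //=.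
  move=> /andP[/andP[hx _] _] sr /and4P[hm' hM' hx' _] umr.
  apply: (@standard_catr [:: m; M; m'; M'; x] r) => //.
  by apply: (@standard5 [:: m; m'; x; M'; M] [:: 0; 4; 1; 3; 2]); rewrite //=; lia.
- by apply: standard_classified; apply: (@standard_catl r [:: m; M]).
Qed.

(** A letter put in front of a bracketed word: if it is extreme, the first five
    letters form a standard word; otherwise the pair [m], [M] moves across it. *)
Lemma classified_left a m M w : 3 < size w -> uniq [:: a, m, M & w] -> bracketed [:: m, M & w] ->
  (forall q, size q = (size w).+1 -> uniq q -> classified q) -> classified [:: a, m, M & w].
Proof.
move=> sw U /and3P[_ aw _] IH.
have [am|ma] := ltnP a m.
  apply: standard_classified; case: w sw U aw {IH} => [|x [|y w]] // _ U /= /and3P[hx hy _].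
  apply: (@standard_catr [:: a; m; M; x; y] w) => //.
  have xy : x != y by move: U; rewrite !cons_uniq !inE !negb_or => /and5P[_ _ _ /andP[]].
  have [lt_xy|le_yx] := ltnP x y.
    by apply: (@standard5 [:: a; m; x; y; M] [:: 0; 1; 4; 2; 3]); rewrite //=; lia.
  by apply: (@standard5 [:: a; m; y; x; M] [:: 0; 1; 4; 3; 2]); rewrite //=; lia.
have [Ma|aM] := ltnP M a.
  apply: standard_classified; case: w sw U aw {IH} => [|x [|y w]] // _ U /= /and3P[hx hy _].
  apply: (@standard_catr [:: a; m; M; x; y] w) => //.
  have xy : x != y by move: U; rewrite !cons_uniq !inE !negb_or => /and5P[_ _ _ /andP[]].
  have [lt_xy|le_yx] := ltnP x y.
    by apply: (@standard5 [:: m; x; y; M; a] [:: 4; 0; 3; 1; 2]); rewrite //=; lia.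
  by apply: (@standard5 [:: m; y; x; M; a] [:: 4; 0; 3; 2; 1]); rewrite //=; lia.
have e : eqv [:: a, m, M & w] [:: m, M, a & w].
  have : (a != m) && (a != M) by move: (U); rewrite /= !inE !negb_or => /andP[/and3P[-> -> _]].
  move=> h; apply: eqv1; exists [::], a, m, M, w; split=> //=.
  by rewrite /flip; do !(case: ifP => //= ?); lia.
have U2 : uniq [:: m, M, a & w] by rewrite -(eqv_uniq e).
apply: (eqv_classified e); apply: classified_mid => //.
- rewrite /= aw andbT; move: U; rewrite /= !inE !negb_or => /andP[/and3P[h1 h2 _] _]; lia.
- by apply: IH => //; move: U2 => /= /and3P[].
Qed.

(** The same with a letter added at the right end: if it is extreme, the pair
    [m], [M] first moves next to it and the last five letters are standard. *)
Lemma classified_right b m M w : 3 < size w -> uniq (rcons [:: m, M & w] b) -> bracketed [:: m, M & w] ->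
  (forall q, size q = (size w).+1 -> uniq q -> classified q) -> classified (rcons [:: m, M & w] b).
Proof.
move=> sw U /and3P[_ aw _] IH.
have U0 : uniq [:: b, m, M & w] by move: U; rewrite rcons_uniq.
have [bin|bout] := boolP (m < b < M).
  rewrite !rcons_cons; apply: classified_mid => //.
  - by rewrite size_rcons.
  - by rewrite all_rcons bin.
  - by apply: IH; [rewrite size_rcons|move: U => /= /and3P[]].
apply: standard_classified; have e := eqv_rcons b (pair_move aw).
have U1 : uniq (rcons (w ++ [:: m; M]) b) by rewrite -(eqv_uniq e).
apply: (eqv_standard e).
case/lastP: w sw U0 aw U1 {IH U e} => // w y; case/lastP: w => // w x _.
rewrite -!cats1 -!catA /= all_cat => U0 /and4P[_ hx hy _] U1.
have xy : x != y.
  by move: U1; rewrite cat_uniq => /and3P[_ _]; rewrite /= inE negb_or => /andP[/andP[]].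
have hb : (b != m) && (b != M).
  by case/andP: U0; rewrite !inE !negb_or => /and3P[-> ->].
apply: standard_catl => //.
have [bm|mb] := ltnP b m; have [lt_xy|le_yx] := ltnP x y.
- by apply: (@standard5 [:: b; m; x; y; M] [:: 2; 3; 1; 4; 0]); rewrite //=; lia.
- by apply: (@standard5 [:: b; m; y; x; M] [:: 3; 2; 1; 4; 0]); rewrite //=; lia.
- by apply: (@standard5 [:: m; x; y; M; b] [:: 1; 2; 0; 3; 4]); rewrite //=; lia.
- by apply: (@standard5 [:: m; y; x; M; b] [:: 2; 1; 0; 3; 4]); rewrite //=; lia.
Qed.

Lemma classified_all p : 4 < size p -> uniq p -> classified p.
Proof.
have [n] := ubnP (size p); elim: n p => // n IH p /ltnSE sp p4 Up.
have [s5|n5] := eqVneq (size p) 5; first exact: (classified_small classes_cover5).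
have [s6|n6] := eqVneq (size p) 6; first exact: (classified_small classes_cover6).
have p7 : 6 < size p by move: p4 n5 n6; rewrite leq_eqVlt eq_sym => /orP[->|] //; lia.
have [p' e [d|[a [x [y [z [b [ep' xz nxyz]]]]]]]] := normal_up Up.
  by exists p' => //; constructor 1.
apply: (eqv_classified e).
have Up' : uniq p' by rewrite -(eqv_uniq e).
have sp' := eqv_size e.
have IH2 k : 4 < k -> k < size p -> forall q, size q = k -> uniq q -> classified q.
  by move=> k4 kp q sq Uq; apply: IH => //; rewrite sq //; lia.
rewrite {}ep' {p' e} in Up' sp' *.
case: a Up' sp' => [|c a] Up' sp'; last first.
  have Uq : uniq (a ++ [:: x, y, z & b]) by case/andP: Up'.
  have sq : size p = (size (a ++ [:: x, y, z & b])).+1 by rewrite sp'.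
  have q4 : 4 < size (a ++ [:: x, y, z & b]) by lia.
  have [|q eq] := IH2 _ q4 _ _ erefl Uq; first by rewrite sq.
  have nd := wild_not_skip_dec xz nxyz Uq eq; have e := eqv_cons c eq.
  have sq2 := eqv_size eq; have U := Up'; rewrite (eqv_uniq e) in U.
  move=> hq; apply: (eqv_classified e); rewrite sq2 in sq q4; move: hq.
  case=> [|cq|Sq]; first by rewrite (negPf nd).
    clear e eq; case: q cq U sq q4 {sq2 nd} => // m [|M w] // cq U /= sq q4.
    have w3 : 3 < size w by move: p7; rewrite sq.
    by apply: classified_left => //; apply: IH2; rewrite ?sq.
  by apply: standard_classified; have [] := standard_ext (a := c) q4 erefl Sq U.
case/lastP: b Up' sp' => [|b c] Up' sp'; first by rewrite sp' in p4.
have {}Up' : uniq (rcons [:: x, y, z & b] c) := Up'.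
have {}sp' : size p = size (rcons [:: x, y, z & b] c) := sp'.
rewrite cat0s -[[:: x, y, z & rcons b c]]/(rcons [:: x, y, z & b] c).
have Uq : uniq [:: x, y, z & b] by move: Up'; rewrite rcons_uniq => /andP[].
have sq : size p = (size [:: x, y, z & b]).+1 by rewrite sp' size_rcons.
have q4 : 4 < size [:: x, y, z & b] by lia.
have [|q eq] := IH2 _ q4 _ _ erefl Uq; first by rewrite sq.
have nd := @wild_not_skip_dec [::] _ _ _ _ _ xz nxyz Uq eq; have e := eqv_rcons c eq.
have sq2 := eqv_size eq; have U := Up'; rewrite (eqv_uniq e) in U.
move=> hq; apply: (eqv_classified e); rewrite sq2 in sq q4; move: hq.
case=> [|cq|Sq]; first by rewrite (negPf nd).
  clear e eq; case: q cq U sq q4 {sq2 nd} => // m [|M w] // cq U /= sq q4.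
  have w3 : 3 < size w by move: p7; rewrite sq.
  by apply: classified_right => //; apply: IH2; rewrite ?sq.
by apply: standard_classified; have [] := standard_ext (a := c) q4 erefl Sq _ => //; move: U; rewrite rcons_uniq.
Qed.

(** * Canonical words are pairwise inequivalent *)

Fixpoint inversions (s : seq nat) : nat :=
  if s is x :: s' then count (gtn x) s' + inversions s' else 0.

Lemma inversions_cat_mod a s t : perm_eq s t -> inversions s = inversions t %[mod 3] ->
  inversions (a ++ s) = inversions (a ++ t) %[mod 3].
Proof.
move=> st; elim: a => //= x a IH /IH e; rewrite !count_cat (seq.permP st).
by apply/eqP; rewrite eqn_modDl; apply/eqP.
Qed.

Lemma step_inversions p q : uniq p -> step p q -> inversions p = inversions q %[mod 3].
Proof.
move=> Up [a [x [y [z [b [ep ->]]]]]]; rewrite {}ep in Up *.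
have [xy yz xz] := uniq_window Up.
apply: inversions_cat_mod.
  by rewrite -(cat1s x) -(cat1s y) -(cat1s z) !catA perm_cat2r perm_sym perm_flip.
rewrite /flip; do !(case: ifP => /= ?); lia.
Qed.

Lemma eqv_inversions p q : uniq p -> eqv p q -> inversions p = inversions q %[mod 3].
Proof.
move=> + e; elim: e => // {}p q' r st _ IH Up; rewrite (step_inversions Up st).
by apply: IH; rewrite -(perm_uniq (step_perm st)).
Qed.

Lemma inversions_std k s : k < 3 -> sorted ltn s -> 2 < size s -> inversions (std k s) = k.
Proof.
move=> k3; elim/std_ind: s => [s h _ h'|a b c so _|x s h IH so _].
- by lia.
- by move: so k3; case: k => [|[|[|k]]] //=; lia.
rewrite std_cons //= IH ?(path_sorted so) // (seq.permP (perm_std k s)).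
rewrite (eq_in_count (a2 := pred0)) ?count_pred0 // => u us.
by have /allP/(_ u us) := order_path_min ltn_trans so; rewrite /= => ?; lia.
Qed.

(** With four letters: 1234 becomes 3214, which has a window 213, while 1243 and
    1423 have a window 132. *)
Lemma std_wild k s : sorted ltn s -> 3 < size s -> ~ tame (std k s).
Proof.
elim/std_ind: s => [s h _ h'|a b c _ //|x s h IH so s3]; first by lia.
rewrite std_cons //.
case: s h IH so s3 => [|a [|b [|c [|d s]]]] //; last first.
  move=> _ IH so _ t; apply: (IH (path_sorted so) isT) => q pq.
  apply: (@mild_cons x); apply: t; elim: pq => [p|p q' r [e [u [v [w [f [uvw -> ->]]]]]] _ IHu].
    exact: ups_refl.
  by apply: ups_step IHu; exists (x :: e), u, v, w, f.
move=> _ _ /= /and4P[xa ab bc _] _ t; case: k t => [|[|k]] t.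
- have /(tame_up t)/tame_mild : up [:: x; a; b; c] [:: b; a; x; c].
    by exists [::], x, a, b, [:: c]; split=> //; lia.
  by move/(_ [:: b] _ _ _ _ erefl); lia.
- by have := tame_mild t (a := [:: x]) erefl; lia.
- by have := tame_mild t (a := [::]) erefl; lia.
Qed.

Lemma carries_eqv m M w y y' :
  tame w -> uniq w -> all (fun u => m < u < M) w ->
  carries m M w y -> eqv y y' -> exists2 w', eqv w w' & carries m M w' y'.
Proof.
move=> tw uw aw cy e; elim: e w tw uw aw cy => [{}y|{}y y1 y2 st _ IH] w tw uw aw cy.
  by exists w => //; apply: eqv_refl.
have [w1 e1 c1] := carries_step tw uw aw cy st.
have [|||w2 e2 c2] := IH w1 _ _ _ c1.
- exact: tame_eqv e1 tw.
- by rewrite -(eqv_uniq e1).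
- by rewrite -(perm_all _ (eqv_perm e1)).
by exists w2 => //; apply: eqv_trans e2.
Qed.

Lemma bracketed_carries m M w : carries m M w (m :: M :: w).
Proof. by exists [::], [::], w. Qed.

Lemma bracketed_inj m M w w2 : uniq w -> skip_dec w -> skip_dec w2 ->
  all (fun u => m < u < M) w -> eqv (m :: M :: w) (m :: M :: w2) -> w = w2.
Proof.
move=> uw dw dw2 aw e.
have [w' e' [a [l [b [dl ew ey]]]]] :=
  carries_eqv (skip_dec_tame dw) uw aw (bracketed_carries m M w) e.
have aw' : all (fun u => m < u < M) w' by rewrite -(perm_all _ (eqv_perm e')).
suff ww2 : w' = w2 by apply: skip_dec_inj => //; rewrite -ww2.
case: a ew ey => [|x a] ew /=; last first.
  case=> xm _; move: aw'; rewrite ew -xm /=; lia.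
case=> ey; case: l dl ew ey => [_ -> [] //|[y1 x1] l] _ ew [Mx _].
by move: aw'; rewrite ew -Mx /=; lia.
Qed.

(** If a word of the class of [m :: M :: w] were standard, it would start with
    [m], and the second and third letters would form a reversed descent of an
    equivalent of [w]. The third letter is then less than [M], hence followed
    there by a larger letter: a window 213. *)
Lemma bracketed_not_std m M w k s : bracketed (m :: M :: w) -> uniq w -> sorted ltn s -> 4 < size s ->
  ~ eqv (m :: M :: w) (std k s).
Proof.
move=> /and3P[w0 aw dw] uw so s4 e.
have [w' e' [a [l [b [dl ew ey]]]]] :=
  carries_eqv (skip_dec_tame dw) uw aw (bracketed_carries m M w) e.
have aw' : all (fun u => m < u < M) w' by rewrite -(perm_all _ (eqv_perm e')).
have mw' := tame_mild (tame_eqv e' (skip_dec_tame dw)).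
have inw u : u \in w' -> m < u < M by move=> h; exact: (allP aw').
have ins u : u \in s -> (u == m) || (u == M) || (u \in w').
  rewrite -(perm_mem (perm_std k s)) -(perm_mem (eqv_perm e)) !inE.
  by rewrite (perm_mem (eqv_perm e')) orbA.
have ms : m \in s by rewrite -(perm_mem (perm_std k s)) -(perm_mem (eqv_perm e)) !inE eqxx.
case: s so s4 e ey ins ms => [|s0 [|s1 [|s2 [|s3 [|s4 s]]]]] // so _ e.
have min0 := order_path_min ltn_trans so.
have min1 := order_path_min ltn_trans (path_sorted so).
have min2 := order_path_min ltn_trans (path_sorted (path_sorted so)).
rewrite std_cons // std_cons //; case: a ew => [|x a] ew /=; last first.
  case=> sx _ _; rewrite inE => /orP[/eqP ms0|/(allP min0) /= s0m].
    have /inw : x \in w' by rewrite ew inE eqxx.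
    by move=> h; clear -h sx ms0; lia.
  have /inw : x \in w' by rewrite ew inE eqxx.
  by move=> h; clear -h sx s0m; lia.
case=> s0m; case: l dl ew => [|[y1 x1] l] /=.
  move=> _ ew [s1M _] /(_ s2); rewrite !inE eqxx !orbT => /(_ isT).
  by move: min0 min1 => /= /and3P[h1 h2 _] /and3P[h3 _ _] /orP[/orP[|]|/inw] h;
    clear -h h1 h2 h3 s1M s0m; lia.
case/andP=> yx dl ew [s1x ey] ins _.
have /inw y1M : y1 \in w' by rewrite ew inE eqxx.
have [y1s2|] : y1 = s2 \/ std k [:: s2, s3, s4 & s] = [:: s4; s2; s3].
- case: s {e so ins min0 min1 min2} ey => [|s5 s]; last by case=> ->; left.
  by case: k => [|[|k]] /= [<-]; [left|left|right].
- have uw' : uniq w' by rewrite -(eqv_uniq e').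
  have [c [t ec]] : exists c t, down2 l ++ b = c :: t.
    case E : (down2 l ++ b) => [|c t]; last by exists c, t.
    case: (l) (b) E ey => [|[? ?] ?] [|? ?] //= _ ey.
    have : size (std k [:: s2, s3, s4 & s]) = _ := congr1 size ey.
    by rewrite (perm_size (perm_std _ _)).
  rewrite ec in ew; have cw : c \in w' by rewrite ew !inE eqxx !orbT.
  have := mild3 (x := y1) (y := x1) (z := c) (b := t); rewrite -ew => /(_ mw').
  move: uw'; rewrite ew /= !inE !negb_or => /and3P[/and3P[_ y1c _] /andP[x1c _] _].
  have : c \in [:: s0, s1, s2, s3, s4 & s].
    rewrite -(perm_mem (perm_std k _)) -(perm_mem (eqv_perm e)) !inE.
    by rewrite (perm_mem (eqv_perm e')) cw !orbT.
  have /inw hc := cw.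
  rewrite inE => /orP[/eqP h|]; first by clear -h hc s0m; lia.
  rewrite inE => /orP[/eqP h|]; first by clear -h x1c s1x; lia.
  rewrite inE => /orP[/eqP h|]; first by clear -h y1c y1s2; lia.
  by move/(allP min2) => /= h1 h2; clear -h1 h2 yx y1s2; lia.
- move=> est; have : [:: s4; s2; s3] = _ := eq_trans (esym est) ey.
  move: min2 => /= /and3P[h1 h2 _]; case=> y1s4.
  case: l {ey ew ins} dl => [_|[y2 x2] l _] /= [h3]; first by clear -h1 h2 h3 y1s4 y1M; lia.
  by move=> _; case: l.
Qed.

(** * From words to permutations *)

Lemma one_line_perm n (s : 'S_n) : perm_eq (one_line s) (iota 1 n).
Proof.
have -> : iota 1 n = map (fun i : 'I_n => i.+1) (enum 'I_n).
  by rewrite -(addn0 1) iotaDl -val_enum_ord -map_comp.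
rewrite /one_line (map_comp (fun i : 'I_n => i.+1) s); apply: perm_map.
apply: uniq_perm; first by rewrite (map_inj_uniq perm_inj) enum_uniq.
  exact: enum_uniq.
move=> i; rewrite mem_enum; apply/mapP; exists ((s^-1)%g i); first by rewrite mem_enum.
by rewrite permKV.
Qed.

Lemma nth_one_line n (s : 'S_n) (i : 'I_n) : nth 0 (one_line s) i = (s i).+1.
Proof. by rewrite (nth_map i) ?size_enum_ord // nth_ord_enum. Qed.

Lemma one_line_inj n : injective (@one_line n).
Proof.
move=> s t e; apply/permP => i; apply/val_inj/succn_inj.
by rewrite -!nth_one_line e.
Qed.

Lemma one_line_ex n w : perm_eq w (iota 1 n) -> exists s : 'S_n, one_line s = w.
Proof.
move=> pw; have sw : size w = n by rewrite (perm_size pw) size_iota.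
have uw : uniq w by rewrite (perm_uniq pw) iota_uniq.
have wb (i : 'I_n) : (nth 0 w i).-1 < n.
  have : nth 0 w i \in w by rewrite mem_nth // sw.
  by rewrite (perm_mem pw) mem_iota; lia.
have w0 (i : 'I_n) : 0 < nth 0 w i.
  have : nth 0 w i \in w by rewrite mem_nth // sw.
  by rewrite (perm_mem pw) mem_iota; lia.
have fi : injective (fun i => Ordinal (wb i)).
  move=> i j [] e; apply/val_inj/eqP; rewrite -(nth_uniq 0 _ _ uw) ?sw; [|exact: ltn_ord|exact: ltn_ord]; apply/eqP.
  by rewrite -(prednK (w0 i)) e prednK.
exists (perm fi); apply: (@eq_from_nth _ 0); rewrite ?size_one_line // => i hi.
by rewrite (nth_one_line _ (Ordinal hi)) permE /= prednK // (w0 (Ordinal hi)).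
Qed.

Lemma is_order3 (s : 'S_3) a b c x y z : one_line s = [:: a; b; c] ->
  is_order_perm [:: x; y; z] s ->
  [/\ (a < b) = (x < y), (b < c) = (y < z), (a < c) = (x < z) &
      [/\ (b < a) = (y < x), (c < b) = (z < y) & (c < a) = (z < x)]].
Proof.
move=> e /andP[_ /forallP h].
have h' (i j : 'I_3) : (nth 0 [:: a; b; c] i < nth 0 [:: a; b; c] j) =
    (nth 0 [:: x; y; z] i < nth 0 [:: x; y; z] j).
  by rewrite -e !nth_one_line ltnS; exact: (eqP (forallP (h i) j)).
pose o0 : 'I_3 := inord 0; pose o1 : 'I_3 := inord 1; pose o2 : 'I_3 := inord 2.
have := h' o0 o1; have := h' o1 o2; have := h' o0 o2.
have := h' o1 o0; have := h' o2 o1; have := h' o2 o0.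
by rewrite !inordK.
Qed.

Lemma is_order3I (s : 'S_3) a b c x y z : one_line s = [:: a; b; c] ->
  [/\ (a < b) = (x < y), (b < c) = (y < z), (a < c) = (x < z) &
      [/\ (b < a) = (y < x), (c < b) = (z < y) & (c < a) = (z < x)]] ->
  is_order_perm [:: x; y; z] s.
Proof.
move=> e [h1 h2 h3 [h4 h5 h6]]; apply/andP; split=> //.
apply/forallP => i; apply/forallP => j; apply/eqP.
rewrite -[s i < s j]ltnS -!nth_one_line e.
by case: i => [[|[|[|i]]] hi] //; case: j => [[|[|[|j]]] hj] //=; rewrite ?ltnn.
Qed.

Lemma one_line3 (s : 'S_3) : exists a b c, one_line s = [:: a; b; c].
Proof.
have := size_one_line s; case: (one_line s) => [|a [|b [|c [|? ?]]]] // _.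
by exists a, b, c.
Qed.

Local Notation K := K_123_321_132_213.

(** Two windows with the same letters are in the same part exactly when they are
    equal or related by [flip]; this is one direction. *)
Lemma same_part_flip x y z v : x != y -> y != z -> x != z -> perm_eq [:: x; y; z] v ->
  same_part K [:: x; y; z] v -> v = [:: x; y; z] \/ v = flip x y z.
Proof.
move=> xy yz xz pv.
have : size v = 3 by rewrite -(perm_size pv).
have uv : uniq v by rewrite -(perm_uniq pv) /= !inE negb_or xy yz xz.
have mv u : u \in v -> u = x \/ u = y \/ u = z.
  by rewrite -(perm_mem pv) !inE => /or3P[]/eqP; [left|right; left|right; right].
case: v pv uv mv => [|a [|b [|c [|? ?]]]] // _ /= uv mv _.
have ma : a = x \/ a = y \/ a = z by apply: mv; rewrite !inE eqxx.
have mb : b = x \/ b = y \/ b = z by apply: mv; rewrite !inE eqxx ?orbT.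
have mc : c = x \/ c = y \/ c = z by apply: mv; rewrite !inE eqxx ?orbT.
have {uv} [ab bc ac] : [/\ a != b, b != c & a != c].
  by move: uv; rewrite !inE negb_or => /andP[/andP[-> ->] /andP[->]].
case/exists_inP=> P PK /exists_inP[s sP /exists_inP[t tP /andP[os ot]]].
have [a1 [b1 [c1 es]]] := one_line3 s; have [a2 [b2 [c2 et]]] := one_line3 t.
have [h1 h2 h3 [h4 h5 h6]] := is_order3 es os.
have [g1 g2 g3 [g4 g5 g6]] := is_order3 et ot.
have vs : [:: a; b; c] \in [:: [:: x; y; z]; [:: x; z; y]; [:: y; x; z]; [:: y; z; x];
    [:: z; x; y]; [:: z; y; x]].
  rewrite !inE !eqseq_cons; move: ab bc ac xy yz xz.
  by case: ma => [|[|]] ->; case: mb => [|[|]] ->; case: mc => [|[|]] ->; rewrite ?eqxx ?orbT.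
clear mv ma mb mc.
have order : [\/ [/\ (x < y) = (a < b), (y < z) = (b < c) & (x < z) = (a < c)],
    (x < y < z \/ z < y < x) /\ (a < b < c \/ c < b < a) |
    (x < z < y \/ y < x < z) /\ (a < c < b \/ b < a < c)].
  move: PK; rewrite /K_123_321_132_213 /add_singletons !inE.
  case/orP=> [/orP[]/eqP eP|/imsetP[r _ eP]].
  - constructor 2; move: sP tP; rewrite eP !inE es et.
    case/orP=> /eqP[? ? ?]; case/orP=> /eqP[? ? ?]; subst; split; lia.
  - constructor 3; move: sP tP; rewrite eP !inE es et.
    case/orP=> /eqP[? ? ?]; case/orP=> /eqP[? ? ?]; subst; split; lia.
  - constructor 1; move: sP tP; rewrite eP !inE => /eqP est /eqP ett.
    rewrite ett -est es in et; case: et => ? ? ?; subst.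
    by rewrite -h1 -h2 -h3 -g1 -g2 -g3.
clear h1 h2 h3 h4 h5 h6 g1 g2 g3 g4 g5 g6 es et os ot sP tP PK.
suff : [:: a; b; c] == [:: x; y; z] \/ [:: a; b; c] == flip x y z.
  by case=> /eqP; [left|right].
rewrite /flip; move: vs; rewrite !inE.
case: order => [[k1 k2 k3]|[k1 k2]|[k1 k2]]; rewrite ?eqseq_cons.
all: do 5?[case/orP]; case/and4P=> /eqP ? /eqP ? /eqP ? _; subst.
all: do !(case: ifP => ?); rewrite ?eqseq_cons ?eqxx; (try by left); (try by right); lia.
Qed.

Lemma flip_same_part x y z : flip x y z != [:: x; y; z] ->
  same_part K [:: x; y; z] (flip x y z).
Proof.
have [s123 e123] : exists s : 'S_3, one_line s = [:: 1; 2; 3] by apply: one_line_ex.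
have [s321 e321] : exists s : 'S_3, one_line s = [:: 3; 2; 1] by apply: one_line_ex.
have [s132 e132] : exists s : 'S_3, one_line s = [:: 1; 3; 2] by apply: one_line_ex.
have [s213 e213] : exists s : 'S_3, one_line s = [:: 2; 1; 3] by apply: one_line_ex.
have sp P s t u v : P \in K -> s \in P -> t \in P -> is_order_perm u s -> is_order_perm v t ->
    same_part K u v.
  move=> PK sP tP us vt; apply/exists_inP; exists P => //; apply/exists_inP; exists s => //.
  by apply/exists_inP; exists t; rewrite ?us ?vt.
rewrite /flip; case: ifP => [/orP[] h _|_].
- apply: (sp (part_of_words 3 [:: [:: 1; 2; 3]; [:: 3; 2; 1]]) s123 s321).
  + by rewrite /K_123_321_132_213 /add_singletons !inE eqxx.
  + by rewrite inE e123.
  + by rewrite inE e321.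
  + by apply: (is_order3I e123); do !split; lia.
  + by apply: (is_order3I e321); do !split; lia.
- apply: (sp (part_of_words 3 [:: [:: 1; 2; 3]; [:: 3; 2; 1]]) s321 s123).
  + by rewrite /K_123_321_132_213 /add_singletons !inE eqxx.
  + by rewrite inE e321.
  + by rewrite inE e123.
  + by apply: (is_order3I e321); do !split; lia.
  + by apply: (is_order3I e123); do !split; lia.
case: ifP => [h _|_].
- apply: (sp (part_of_words 3 [:: [:: 1; 3; 2]; [:: 2; 1; 3]]) s132 s213).
  + by rewrite /K_123_321_132_213 /add_singletons !inE eqxx orbT.
  + by rewrite inE e132.
  + by rewrite inE e213.
  + by apply: (is_order3I e132); do !split; lia.
  + by apply: (is_order3I e213); do !split; lia.
case: ifP => [h _|_]; last by rewrite eqxx.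
apply: (sp (part_of_words 3 [:: [:: 1; 3; 2]; [:: 2; 1; 3]]) s213 s132).
+ by rewrite /K_123_321_132_213 /add_singletons !inE eqxx orbT.
+ by rewrite inE e213.
+ by rewrite inE e132.
+ by apply: (is_order3I e213); do !split; lia.
+ by apply: (is_order3I e132); do !split; lia.
Qed.

Lemma K_equiv_step n (phi : 'S_n) q : step (one_line phi) q ->
  exists2 chi, one_line chi = q & K_equiv K phi chi.
Proof.
move=> st; have pq : perm_eq q (iota 1 n).
  by rewrite -(permPl (step_perm st)) one_line_perm.
have [chi ec] := one_line_ex pq; exists chi => //.
case: st => a [x [y [z [b [e1 e2]]]]].
have [ef|nf] := eqVneq (flip x y z) [:: x; y; z].
  rewrite (_ : chi = phi); first exact: connect0.
  by apply: one_line_inj; rewrite ec e1 e2 ef.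
apply: connect1; apply/K_stepP; exists a, [:: x; y; z], (flip x y z), b.
split=> //; first by rewrite ec.
  by rewrite (perm_size (perm_flip _ _ _)).
exact: flip_same_part.
Qed.

Lemma K_equivP n (phi psi : 'S_n) : 
  reflect (eqv (one_line phi) (one_line psi)) (K_equiv K phi psi).
Proof.
apply: (iffP idP).
  case/connectP=> l; elim: l phi => [|chi l IH] phi /=; first by move=> _ ->; apply: eqv_refl.
  case/andP=> /K_stepP[a [u [v [b [e1 e2 su sv suv]]]]] pl el.
  apply: eqv_trans (IH chi pl el).
  have puv : perm_eq u v.
    have := one_line_perm chi; rewrite -(permPr (one_line_perm phi)) e1 e2.
    by rewrite perm_cat2l perm_cat2r perm_sym.
  have := perm_uniq (one_line_perm phi); rewrite iota_uniq e1 => Uu.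
  case: u su e1 puv suv Uu => [|x [|y [|z [|? ?]]]] // _ e1 puv suv /uniq_window[xy yz xz].
  case: (same_part_flip xy yz xz puv suv) => ev; rewrite e2 ev.
    exact: eqv_refl.
  by apply: eqv1; exists a, x, y, z, b.
suff gen w w' : eqv w w' -> forall phi, one_line phi = w -> one_line psi = w' -> K_equiv K phi psi.
  by move/gen; apply.
elim=> {w w'} [w|w q r st _ IH] {}phi ew er.
  by rewrite (one_line_inj (eq_trans ew (esym er))); apply: connect0.
rewrite -ew in st; have [chi ec pc] := K_equiv_step st.
by apply: (connect_trans pc); apply: IH.
Qed.

(** * Counting *)

(** The number of classes is the size of a system of representatives. *)
Lemma count_classes (T : finType) (R : rel T) (X : {set T}) : equivalence_rel R ->
  (forall x, exists2 y, y \in X & R x y) -> {in X &, forall x y, R x y -> x = y} ->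
  #|equivalence_partition R [set: T]| = #|X|.
Proof.
move=> eR cX iX; have [Rr Rl] : reflexive R /\ left_transitive R by apply/equivalence_relP.
rewrite -(@card_in_imset _ _ (fun x => [set y in [set: T] | R x y]) X).
  apply: eq_card => B; apply/imsetP/imsetP => -[x xX ->]; last by exists x.
  have [y yX xy] := cX x; exists y => //.
  by apply/setP => z; rewrite !inE (Rl _ _ xy).
move=> x y xX yX /setP/(_ y); rewrite !inE Rr => xy; exact: iX.
Qed.

(** The skip-decreasing words on the letters 0, ..., n - 1. *)
Definition skip_dec_words n : seq (seq nat) := [seq w <- permutations (iota 0 n) | skip_dec w].

Lemma mem_skip_dec_words n w : (w \in skip_dec_words n) = skip_dec w && perm_eq w (iota 0 n).
Proof. by rewrite mem_filter mem_permutations. Qed.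

Lemma gtn_trans : transitive gtn.
Proof. by move=> y x z /= yx zy; apply: ltn_trans zy yx. Qed.

Lemma gtn_irr : irreflexive gtn.
Proof. by move=> x /=; rewrite ltnn. Qed.

Lemma skip_dec_evens w : skip_dec w -> sorted gtn (odds (behead w)).
Proof. by case: w => //= x w /andP[_ /skip_dec_odds]. Qed.

(** The converse of [skip_dec_odds] and [skip_dec_evens]. *)
Lemma skip_dec_interleave w : sorted gtn (odds w) -> sorted gtn (odds (behead w)) -> skip_dec w.
Proof.
elim/seq2_ind: w => // x y [|z w] //= IH so se.
have/andP[zx so'] : (z < x) && path gtn z (if w is _ :: t then odds t else [::]) by [].
rewrite zx /=; case: w IH so se so' => [|t w] //= IH so /andP[ty se] so'.
by rewrite ty /=; apply: IH.
Qed.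

Lemma size_odds w : size (odds w) = uphalf (size w).
Proof. by elim/seq2_ind: w => // x y w /= ->. Qed.

Lemma interleave_ex o e : (size o == size e) || (size o == (size e).+1) ->
  exists2 w, odds w = o & odds (behead w) = e.
Proof.
elim: o e => [|x o IH] [|y e] //=; first by exists [::].
  by case: o {IH} => // _; exists [:: x].
by rewrite !eqSS => /IH[w <- <-]; exists [:: x, y & w]; case: w.
Qed.

(** The letters in odd places, as a set. *)
Definition oddset n (w : seq nat) : {set 'I_n} := [set i | val i \in odds w].

Lemma oddset_inj n : {in skip_dec_words n &, injective (oddset n)}.
Proof.
move=> w w'; rewrite !mem_skip_dec_words => /andP[dw pw] /andP[dw' pw'] e.
have pww : perm_eq w w' by rewrite (permPl pw) perm_sym.
have mo u : u \in odds w -> u < n.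
  by move=> h; have := perm_mem (perm_odds w) u; rewrite mem_cat h /= (perm_mem pw) mem_iota => /esym.
have mo' u : u \in odds w' -> u < n.
  by move=> h; have := perm_mem (perm_odds w') u; rewrite mem_cat h /= (perm_mem pw') mem_iota => /esym.
have oo : odds w = odds w'.
  apply: (irr_sorted_eq gtn_trans gtn_irr); rewrite ?skip_dec_odds // => u.
  apply/idP/idP => h.
    by have /setP/(_ (Ordinal (mo _ h))) := e; rewrite !inE h => <-.
  by have /setP/(_ (Ordinal (mo' _ h))) := e; rewrite !inE h => ->.
apply: odds_inj => //; apply: (irr_sorted_eq gtn_trans gtn_irr); rewrite ?skip_dec_evens // => u.
apply: perm_mem; rewrite -(perm_cat2l (odds w)) (permPl (perm_odds w)) oo.
by rewrite (permPl pww) perm_sym perm_odds.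
Qed.

(** Skip-decreasing words correspond to the possible sets of letters in the odd
    places. *)
Lemma size_skip_dec_words n : size (skip_dec_words n) = 'C(n, n %/ 2).
Proof.
have -> : 'C(n, n %/ 2) = 'C(n, uphalf n).
  by rewrite -bin_sub ?leq_div // divn2 -{2}(odd_double_half n); congr binomial; lia.
rewrite -[X in 'C(X, _)](card_ord n) -card_draws -(size_map (oddset n)) cardE.
apply/perm_size/uniq_perm.
- by rewrite map_inj_in_uniq ?filter_uniq ?permutations_uniq //; apply: oddset_inj.
- exact: enum_uniq.
move=> A; rewrite mem_enum inE; apply/mapP/idP => [[w]|/eqP cA].
  rewrite mem_skip_dec_words => /andP[dw pw] ->.
  have uo : uniq (odds w) by apply: (sorted_uniq gtn_trans gtn_irr); apply: skip_dec_odds.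
  have so : size (odds w) = uphalf n by rewrite size_odds (perm_size pw) size_iota.
  rewrite -so cardE -(size_map val); apply/eqP/perm_size/uniq_perm => //.
    by rewrite (map_inj_uniq val_inj) enum_uniq.
  move=> u; apply/mapP/idP => [[i]|uw]; first by rewrite mem_enum inE => h ->.
  have un : u < n.
    by have := perm_mem (perm_odds w) u; rewrite mem_cat uw /= (perm_mem pw) mem_iota => /esym.
  by exists (Ordinal un) => //; rewrite mem_enum inE.
pose desc (B : {set 'I_n}) := rev (map val (enum B)).
have sdesc B : sorted gtn (desc B).
  rewrite /desc rev_sorted -[enum B](eq_filter (mem_enum _)).
  rewrite -(eq_filter (mem_map val_inj _)) -filter_map.
  by rewrite (sorted_filter ltn_trans) // -enumT val_enum_ord iota_ltn_sorted.
have [|w ow ew] := @interleave_ex (desc A) (desc (~: A)).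
  rewrite !size_rev !size_map -!cardE.
  have := cardsC A; rewrite card_ord cA; move: #|~: A| => k ek.
  have := odd_double_half n; lia.
have pw : perm_eq w (iota 0 n).
  rewrite -(permPl (perm_odds w)) ow ew -val_enum_ord.
  apply: (@perm_trans _ (map val (enum A) ++ map val (enum (~: A)))).
    by apply: perm_cat; rewrite perm_rev.
  rewrite -map_cat perm_map //; apply: uniq_perm; rewrite ?enum_uniq //.
    rewrite cat_uniq !enum_uniq andbT /=; apply/hasPn => i; rewrite !mem_enum inE //.
  by move=> i; rewrite mem_cat !mem_enum !inE orbN.
exists w.
  by rewrite mem_skip_dec_words pw andbT; apply: skip_dec_interleave; rewrite ?ow ?ew.
apply/setP => i; rewrite inE ow /desc mem_rev mem_map ?mem_enum //; exact: val_inj.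
Qed.

Lemma skip_dec_addn c p : skip_dec (map (addn c) p) = skip_dec p.
Proof. by elim: p => //= x [|y [|z s]] //= ->; rewrite ltn_add2l. Qed.

Lemma perm_iota_shift c n q : perm_eq q (iota c n) ->
  exists2 q0, perm_eq q0 (iota 0 n) & q = map (addn c) q0.
Proof.
move=> pq; exists (map (subn^~ c) q).
  have -> : iota 0 n = map (subn^~ c) (iota c n).
    rewrite -[in RHS](addn0 c) iotaDl -map_comp -[LHS]map_id.
    by apply: eq_map => i /=; rewrite addn0 addKn.
  exact: perm_map.
rewrite -map_comp -[LHS]map_id; apply/eq_in_map => x.
by rewrite (perm_mem pq) mem_iota => /andP[cx _] /=; rewrite subnKC.
Qed.

(** The canonical words on the letters 1, ..., n. *)
Definition reps n : seq (seq nat) :=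
  [seq map (addn 1) w | w <- skip_dec_words n]
  ++ [seq 1 :: n :: map (addn 2) w | w <- skip_dec_words (n - 2)]
  ++ [seq std k (iota 1 n) | k <- [:: 0; 1; 2]].

Lemma iota_ends n : 4 < n -> iota 1 n = 1 :: rcons (iota 2 (n - 2)) n.
Proof.
move=> n4; have e : n = (1 + (n - 2)) + 1 by lia.
rewrite {1}e !iotaD -cats1 /=; congr (_ :: _ ++ [:: _]); lia.
Qed.

Lemma repsI n w : w \in [seq map (addn 1) w | w <- skip_dec_words n] = skip_dec w && perm_eq w (iota 1 n).
Proof.
apply/mapP/andP => [[v]|[dw /perm_iota_shift[v pv ev]]].
  rewrite mem_skip_dec_words => /andP[dv pv] ->; rewrite skip_dec_addn dv; split=> //.
  by rewrite -[in iota 1 n](addn0 1) iotaDl perm_map.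
by exists v => //; rewrite mem_skip_dec_words pv -(skip_dec_addn 1) -ev dw.
Qed.

Lemma repsII n q : 4 < n -> q \in [seq 1 :: n :: map (addn 2) w | w <- skip_dec_words (n - 2)] ->
  exists w, [/\ q = [:: 1, n & w], bracketed q, uniq w & perm_eq q (iota 1 n)].
Proof.
move=> n4 /mapP[w]; rewrite mem_skip_dec_words => /andP[dw pw] ->; exists (map (addn 2) w).
have pw2 : perm_eq (map (addn 2) w) (iota 2 (n - 2)).
  by rewrite -[in iota 2 _](addn0 2) iotaDl perm_map.
split=> //.
- apply/and3P; split; last by rewrite skip_dec_addn.
    by have := perm_size pw; rewrite size_iota; case: (w) => //=; lia.
  by rewrite (perm_all _ pw2); apply/allP => u; rewrite mem_iota; lia.
- by rewrite (perm_uniq pw2) iota_uniq.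
- rewrite iota_ends // perm_cons perm_sym perm_rcons perm_cons perm_sym //.
Qed.

Lemma repsIII n q : q \in [seq std k (iota 1 n) | k <- [:: 0; 1; 2]] ->
  exists2 k, k < 3 & q = std k (iota 1 n).
Proof. by case/mapP=> k kin ->; exists k => //; move: kin; rewrite !inE => /or3P[]/eqP->. Qed.

Lemma sorted_iota n : sorted ltn (iota 1 n).
Proof. exact: iota_ltn_sorted. Qed.

Lemma reps_perm n w : 4 < n -> w \in reps n -> perm_eq w (iota 1 n).
Proof.
move=> n4; rewrite !mem_cat repsI => /or3P[/andP[_ //]|/(repsII n4)[v [_ _ _ //]]|].
by case/repsIII=> k _ ->; apply: perm_std.
Qed.

Lemma eqv_reps n w w' : 4 < n -> w \in reps n -> w' \in reps n -> eqv w w' -> w = w'.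
Proof.
move=> n4 hw hw' e.
have iu := iota_uniq 1 n; have si := sorted_iota n.
have s3 : 3 < size (iota 1 n) by rewrite size_iota; lia.
have s4 : 4 < size (iota 1 n) by rewrite size_iota; lia.
have uw : uniq w by rewrite (perm_uniq (reps_perm n4 hw)).
have e' := eqv_sym uw e.
have uw' : uniq w' by rewrite -(eqv_uniq e).
have tII q : uniq q -> bracketed q -> ~ tame q.
  case: q => [|m [|M [|x q]]] // _ /and3P[_ /= /andP[/andP[h1 h2] _] _] /tame_mild/mild3.
  lia.
have cl q q' : eqv q q' -> skip_dec q -> tame q' by move=> qq /skip_dec_tame; apply: tame_eqv.
move: hw hw'; rewrite !mem_cat !repsI.
case/or3P=> [/andP[dw _]|hw|hw]; case/or3P=> [/andP[dw' _]|hw'|hw'].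
- exact: skip_dec_inj.
- have [v [ev cv uv _]] := repsII n4 hw'.
  by case: (tII w') => //; apply: cl e dw.
- have [k _ ek] := repsIII hw'.
  by case: (std_wild (k := k) si s3); rewrite -ek; apply: cl e dw.
- have [v [ev cv uv _]] := repsII n4 hw.
  by case: (tII w) => //; apply: cl e' dw'.
- have [v [ev cv uv _]] := repsII n4 hw; have [v' [ev' cv' uv' _]] := repsII n4 hw'.
  rewrite ev ev' in e cv cv' *; congr [:: _, _ & _].
  case/and3P: cv => _ av dv; case/and3P: cv' => _ _ dv'.
  exact: bracketed_inj uv dv dv' av e.
- have [v [ev cv uv _]] := repsII n4 hw; have [k _ ek] := repsIII hw'.
  by rewrite ev ek in e cv; case: (bracketed_not_std cv uv si s4 e).
- have [k _ ek] := repsIII hw.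
  by case: (std_wild (k := k) si s3); rewrite -ek; apply: cl e' dw'.
- have [v [ev cv uv _]] := repsII n4 hw'; have [k _ ek] := repsIII hw.
  by rewrite ev ek in e' cv; case: (bracketed_not_std cv uv si s4 e').
- have [k k3 ek] := repsIII hw; have [k' k3' ek'] := repsIII hw'.
  have := eqv_inversions uw e; rewrite ek ek' !inversions_std ?(ltnW s3) // !modn_small //.
  by move->.
Qed.

Lemma reps_complete n w : 4 < n -> perm_eq w (iota 1 n) -> exists2 q, q \in reps n & eqv w q.
Proof.
move=> n4 pw; have sw : size w = n by rewrite (perm_size pw) size_iota.
have uw : uniq w by rewrite (perm_uniq pw) iota_uniq.
have [||q wq h] := classified_all (p := w); [by rewrite sw|by []|].
have pq : perm_eq q (iota 1 n) by rewrite -(permPl (eqv_perm wq)).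
case: h => [dq|cq|[k0 [s [so e]]]].
- by exists q; rewrite // mem_cat repsI dq pq.
- exists q => //; rewrite !mem_cat; apply/orP; right; apply/orP; left.
  case: q cq wq pq => [|m [|M v]] // /and3P[v0 av dv] _ pq.
  have bounds u : u \in [:: m, M & v] -> 0 < u <= n by rewrite (perm_mem pq) mem_iota; lia.
  have mM : m < M by case: v v0 av {dv pq bounds} => //= u v _ /andP[/andP[mu uM] _]; apply: ltn_trans mu uM.
  have ins u : 0 < u <= n -> [|| u == m, u == M | m < u < M].
    move=> hu; have : u \in [:: m, M & v] by rewrite (perm_mem pq) mem_iota; lia.
    by rewrite !inE => /or3P[->|->|/(allP av) /= ->]; rewrite ?orbT.
  have m1 : m = 1.
    by have := bounds m; rewrite !inE eqxx => /(_ isT); have := ins 1; lia.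
  have Mn : M = n.
    by have := bounds M; rewrite !inE eqxx orbT => /(_ isT); have := ins n; lia.
  subst m M.
  have pv : perm_eq v (iota 2 (n - 2)).
    move: pq; rewrite iota_ends // perm_cons perm_sym perm_rcons perm_cons perm_sym //.
  have [v1 pv1 ev] := perm_iota_shift pv.
  by apply/mapP; exists v1; rewrite ?ev // mem_skip_dec_words pv1 -(skip_dec_addn 2) -ev dv.
- have [k kin ek] := std_le2 k0 s.
  have es : s = iota 1 n.
    apply: (irr_sorted_eq ltn_trans ltnn) => //; first exact: sorted_iota.
    apply: perm_mem; rewrite -(permPl (perm_std k0 s)) -(permPl (eqv_perm e)) //.
  exists (std k (iota 1 n)); last by apply: eqv_trans wq _; rewrite -es -ek.
  by rewrite !mem_cat (map_f (fun k => std k _)) ?orbT.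
Qed.

Lemma uniq_reps n : 4 < n -> uniq (reps n).
Proof.
move=> n4; have s3 : 2 < size (iota 1 n) by rewrite size_iota; lia.
have addI c : injective (map (addn c)) by apply: inj_map; apply: addnI.
have bu m : uniq (skip_dec_words m) by rewrite filter_uniq ?permutations_uniq.
have si := sorted_iota n.
have tII q : bracketed q -> ~ skip_dec q.
  by case: q => [|m [|M [|x q]]] // /and3P[_ /= /andP[/andP[h1 h2] _] _] /andP[]; lia.
have tIII k : ~ skip_dec (std k (iota 1 n)).
  move/skip_dec_tame; apply: std_wild => //; by rewrite size_iota; lia.
rewrite /reps !cat_uniq; apply/and3P; split; last (apply/and3P; split).
- by rewrite map_inj_uniq.
- apply/hasPn => q; rewrite mem_cat => hq; rewrite /= repsI; apply/negP => /andP[dq _].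
  case/orP: hq => [/(repsII n4)[v [_ c _ _]]|/repsIII[k _ eq]]; first exact: (tII q).
  by apply: (tIII k); rewrite -eq.
- by rewrite map_inj_uniq // => u v [] /addI.
- apply/hasPn => q /repsIII[k _ eq]; apply/negP => /(repsII n4)[v [ev c uv _]].
  rewrite ev in c; apply: (bracketed_not_std c uv si (k := k)); first by rewrite size_iota.
  by rewrite -eq ev; exact: eqv_refl.
- rewrite /= !inE !negb_or andbT.
  have ne k k' : k < 3 -> k' < 3 -> k != k' -> std k (iota 1 n) != std k' (iota 1 n).
    by move=> h h'; apply: contraNN => /eqP/(congr1 inversions); rewrite !inversions_std // => ->.
  by rewrite !ne.
Qed.

Theorem proposition3p74 (n : nat) (hn : 4 < n) :
  num_K_classes K_123_321_132_213 n = 'C(n, n %/ 2) + 'C(n - 2, (n - 2) %/ 2) + 3.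
Proof.
have -> : 'C(n, n %/ 2) + 'C(n - 2, (n - 2) %/ 2) + 3 = size (reps n).
  by rewrite /reps !size_cat !size_map !size_skip_dec_words addnA.
rewrite /num_K_classes (@count_classes _ _ [set s : 'S_n | one_line s \in reps n]).
- rewrite cardE -(size_map (@one_line n)); apply/perm_size/uniq_perm.
  + by rewrite (map_inj_uniq (@one_line_inj n)) enum_uniq.
  + exact: uniq_reps.
  move=> w; apply/mapP/idP => [[s]|hw]; first by rewrite mem_enum inE => h ->.
  have [s es] := one_line_ex (reps_perm hn hw).
  by exists s; rewrite // mem_enum inE es.
- exact: K_equiv_equivalence.
- move=> s; have [w hw e] := reps_complete hn (one_line_perm s).
  have [t et] := one_line_ex (reps_perm hn hw).
  by exists t; [rewrite inE et|apply/K_equivP; rewrite et].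
- move=> s t; rewrite !inE => hs ht /K_equivP e.
  by apply: one_line_inj; apply: (eqv_reps hn hs ht e).
Qed.
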